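(* Let $A$ be an artinian local ring. For every $f \in A((t))^\times$ such that $1-f \in A((t))^\times$, one has $$\langle f, 1-f\rangle_{A((t))^\times} = 1,$$ where $\langle\cdot,\cdot\rangle_{A((t))^\times}$ is the Contou-Carrère symbol.
   Context: Rings are commutative with unit, and $R^\times$ denotes the group of units of a ring $R$. $A((t))$ is the ring of series $\sum_{i\in\mathbb{Z}} a_i t^i$ with $a_i\in A$ and $a_i=0$ for $i\ll 0$. Let $m$ be the maximal ideal of the artinian local ring $A$. Every $f\in A((t))^\times$ can be written in exactly one way as $$f = a_0\cdot t^{w(f)}\cdot \prod_{i=1}^{\infty}(1-a_i t^i)\cdot\prod_{i=1}^{\infty}(1-a_{-i}t^{-i}),$$ with $w(f)\in\mathbb{Z}$ (the winding number of $f$), $a_0\in A^\times$, $a_i\in A$ and $a_{-i}\in m$ for $i>0$, and $a_{-i}=0$ for $i\gg 0$. If $g\in A((t))^\times$ is written in the same way with coefficients $b_i$ and winding number $w(g)$, the Contou-Carrère symbol of $f$ and $g$ is $$\langle f,g\rangle_{A((t))^\times} := (-1)^{w(f)w(g)}\,\frac{a_0^{w(g)}\prod_{i=1}^{\infty}\prod_{j=1}^{\infty}\bigl(1-a_i^{j/(i,j)}b_{-j}^{i/(i,j)}\bigr)^{(i,j)}}{b_0^{w(f)}\prod_{i=1}^{\infty}\prod_{j=1}^{\infty}\bigl(1-a_{-i}^{j/(i,j)}b_{j}^{i/(i,j)}\bigr)^{(i,j)}}\in A^\times,$$ where $(i,j)$ denotes the greatest common divisor; only finitely many factors in the infinite products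 differ from $1$. *)

(* Defs.v *)
From HB Require Import structures.
From mathcomp Require Import all_boot all_order all_algebra.
From mathcomp Require Import boolp classical_sets functions cardinality fsbigop.
From mathcomp Require Import zify ring.

Set Implicit Arguments.
Unset Strict Implicit.
Unset Printing Implicit Defensive.
Import Order.TTheory GRing.Theory Num.Theory.
Local Open Scope classical_set_scope.
Local Open Scope ring_scope.

Section ArtinianLocal.
Variable A : comUnitRingType.
Implicit Types I J m : set A.

Definition ideal I : Prop :=
  [/\ I 0, (forall x y, I x -> I y -> I (x + y)) & forall a x, I x -> I (a * x)].

Definition maximal_ideal m : Prop :=
  [/\ ideal m, ~ m 1 & forall J, ideal J -> ~ J 1 -> m `<=` J -> J = m].

Definition is_local_with m : Prop :=
  maximal_ideal m /\ forall m', maximal_ideal m' -> m' = m.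

Definition artinian : Prop :=
  forall I : nat -> set A, (forall n, ideal (I n)) ->
    (forall n, I n.+1 `<=` I n) -> exists N, forall n, (N <= n)%N -> I n = I N.

End ArtinianLocal.

Section Laurent.
Variable A : comUnitRingType.

Definition bounded_below : {pred int -> A} :=
  fun c => `[< exists N : int, forall i, i < N -> c i = 0 >].

(* The ring A((t)): the coercion lcoef sends a series to its coefficients. *)
Record laurent := Laurent { lcoef :> int -> A; _ : lcoef \in bounded_below }.

HB.instance Definition _ := [isSub for lcoef].
HB.instance Definition _ := [Choice of laurent by <:].

Lemma bounded_belowP (c : int -> A) :
  reflect (exists N : int, forall i, i < N -> c i = 0) (c \in bounded_below).
Proof. exact: asboolP. Qed.

Fact bounded_below_zmod : zmod_closed bounded_below.
Proof.
split=> [|c d /bounded_belowP[N cN] /bounded_belowP[M dM]].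
  by apply/bounded_belowP; exists 0.
apply/bounded_belowP; exists (Num.min N M) => i.
rewrite lt_min => /andP[iN iM].
by rewrite /GRing.add /GRing.opp /= cN // dM // subr0.
Qed.

HB.instance Definition _ :=
  GRing.isZmodClosed.Build (int -> A) bounded_below bounded_below_zmod.
HB.instance Definition _ := [SubChoice_isSubZmodule of laurent by <:].

Lemma laurentP (f g : laurent) : (forall n, f n = g n) -> f = g.
Proof. by move=> fg; apply/val_inj/funext. Qed.

Lemma laurentD (f g : laurent) n : (f + g) n = f n + g n.
Proof. by []. Qed.

Definition mul_coef (f g : int -> A) (n : int) : A :=
  \sum_(i \in [set: int]) f i * g (n - i).

Lemma mul_coefE (f g : int -> A) (N M : int) (K k : nat) :
    (forall i, i < N -> f i = 0) -> (forall i, i < M -> g i = 0) -> (k < K)%N ->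
  mul_coef f g (N + M + k%:Z) =
    ((\poly_(i < K) f (N + i%:Z)) * \poly_(i < K) g (M + i%:Z))`_k.
Proof.
move=> fN gM kK; rewrite coefM /mul_coef.
pose h (i : nat) := N + i%:Z.
have hinj : injective h by move=> i j /addrI [].
have hD i : h i - N = i%:Z by rewrite /h addrC addrA addNr add0r.
rewrite (fsbigE (map h (iota 0 k.+1))); first last.
- move=> i _ ir.
  have [iN|Ni] := ltP i N; first by rewrite fN // mul0r.
  rewrite [X in _ * X]gM ?mulr0 //.
  have [j ij] : exists j : nat, i = h j.
    by exists `|i - N|%N; rewrite /h; lia.
  move: ir; rewrite ij mem_map // mem_iota /= add0n ltnS -ltnNge => kj.
  by move: kj; rewrite /h; lia.
- by move=> i _.
- by rewrite map_inj_uniq ?iota_uniq.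
rewrite (eq_bigl xpredT) => [|i]; last by rewrite in_setT.
rewrite big_map -[iota 0 k.+1]/(index_iota 0 k.+1) big_mkord.
apply: eq_bigr => i _; have ik : (i <= k)%N by rewrite -ltnS.
rewrite !coef_poly (leq_ltn_trans ik kK) (leq_ltn_trans (leq_subr i k) kK).
by congr (_ * g _); rewrite /h -subzn //; ring.
Qed.

Lemma mul_coef_lt (f g : int -> A) (N M n : int) :
    (forall i, i < N -> f i = 0) -> (forall i, i < M -> g i = 0) ->
  n < N + M -> mul_coef f g n = 0.
Proof.
move=> fN gM nNM; apply: fsbig1 => i _.
have [iN|Ni] := ltP i N; first by rewrite fN // mul0r.
by rewrite [X in _ * X]gM ?mulr0 //; lia.
Qed.

Fact mul_coef_bounded (f g : laurent) : mul_coef f g \in bounded_below.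
Proof.
have /bounded_belowP[N fN] := valP f; have /bounded_belowP[M gM] := valP g.
by apply/bounded_belowP; exists (N + M) => n; apply: mul_coef_lt.
Qed.

Definition mul_laurent (f g : laurent) : laurent :=
  Laurent (mul_coef_bounded f g).

Fact monom_bounded (a : A) (n : int) :
  (fun i : int => if i == n then a else 0) \in bounded_below.
Proof. by apply/bounded_belowP; exists n => i /lt_eqF->. Qed.

(* The monomial a t^n *)
Definition monom (a : A) (n : int) : laurent := Laurent (monom_bounded a n).

Fact laurent_lb (f : laurent) : exists N : int, forall i, i < N -> f i = 0.
Proof. exact: (bounded_belowP _ (valP f)). Qed.

Fact int_split (N n : int) : N <= n -> exists k : nat, n = N + k%:Z.
Proof. by move=> Nn; exists `|n - N|%N; lia. Qed.

Fact mul_laurentC : commutative mul_laurent.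
Proof.
move=> f g; apply: laurentP => n /=.
have [N fN] := laurent_lb f; have [M gM] := laurent_lb g.
have [nNM|/int_split[k ->]] := ltP n (N + M).
  by rewrite (mul_coef_lt fN gM) // (mul_coef_lt gM fN) // addrC.
rewrite (mul_coefE fN gM (leqnn k.+1)) mulrC -(mul_coefE gM fN (leqnn k.+1)).
by rewrite [N + M]addrC.
Qed.

Fact mul_laurentA : associative mul_laurent.
Proof.
move=> f g h; apply: laurentP => n /=.
have [N fN] := laurent_lb f; have [M gM] := laurent_lb g; have [L hL] := laurent_lb h.
have fgNM i : i < N + M -> mul_coef f g i = 0 by apply: mul_coef_lt.
have ghML i : i < M + L -> mul_coef g h i = 0 by apply: mul_coef_lt.
have [nNM|/int_split[k ->]] := ltP n (N + M + L).
  by rewrite (mul_coef_lt fN ghML) ?addrA // (mul_coef_lt fgNM hL).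
rewrite (mul_coefE fgNM hL (leqnn k.+1)) -[N + M + L]addrA.
rewrite (mul_coefE fN ghML (leqnn k.+1)).
set p := \poly_(i < _) f _; set r := \poly_(i < _) h _.
pose q := \poly_(i < k.+1) g (M + i%:Z).
transitivity ((p * (q * r))`_k).
  rewrite !coefM; apply: eq_bigr => i _; congr (_ * _).
  have jk : (k - i < k.+1)%N by rewrite ltnS leq_subr.
  by rewrite coef_poly jk (mul_coefE gM hL jk).
rewrite mulrA !coefM; apply: eq_bigr => i _; congr (_ * _).
by rewrite coef_poly ltn_ord (mul_coefE fN gM (ltn_ord i)).
Qed.

Fact mul_1laurent : left_id (monom 1 0) mul_laurent.
Proof.
move=> f; apply: laurentP => n /=; rewrite /mul_coef.
rewrite (fsbigE [:: 0]) //= => [|i _]; last first.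
  by rewrite inE => /negPf->; rewrite mul0r.
by rewrite big_cons big_nil in_setT eqxx mul1r subr0 addr0.
Qed.

Fact mul_laurentDl : left_distributive mul_laurent +%R.
Proof.
move=> f g h; apply: laurentP => n; rewrite laurentD /=.
have [N fN] := laurent_lb f; have [M gM] := laurent_lb g; have [L hL] := laurent_lb h.
pose P := Num.min N M.
have fP i : i < P -> f i = 0 by rewrite lt_min => /andP[/fN].
have gP i : i < P -> g i = 0 by rewrite lt_min => /andP[_ /gM].
have fgP i : i < P -> (f + g) i = 0.
  by move=> iP; rewrite laurentD fP // gP // addr0.
have [nPL|/int_split[k ->]] := ltP n (P + L).
  by rewrite (mul_coef_lt fgP hL) // (mul_coef_lt fP hL) // (mul_coef_lt gP hL) // addr0.
rewrite (mul_coefE fgP hL (leqnn _)) (mul_coefE fP hL (leqnn _)).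
rewrite (mul_coefE gP hL (leqnn _)) -coefD -mulrDl; congr (nth 0 (polyseq (_ * _)) k).
by apply/polyP => i; rewrite coefD !coef_poly; case: ifP => // _; rewrite addr0.
Qed.

Fact laurent1_neq0 : monom 1 0 != 0.
Proof.
by apply/eqP => /(congr1 (fun f : laurent => f 0)) /eqP; rewrite /= oner_eq0.
Qed.

HB.instance Definition _ := GRing.Zmodule_isComNzRing.Build laurent
  mul_laurentA mul_laurentC mul_1laurent mul_laurentDl laurent1_neq0.

Definition laurent_unit : {pred laurent} :=
  fun f => `[< exists g : laurent, g * f = 1 >].

Definition laurent_inv (f : laurent) : laurent := xget f [set g | g * f = 1].

Fact laurent_mulVr : {in laurent_unit, left_inverse 1 laurent_inv *%R}.
Proof. by move=> f /asboolP fu; apply: (xgetPex f fu). Qed.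

Fact laurent_unitPl (f g : laurent) : g * f = 1 -> laurent_unit f.
Proof. by move=> gf; apply/asboolP; exists g. Qed.

Fact laurent_inv_out : {in [predC laurent_unit], laurent_inv =1 id}.
Proof.
by move=> f /asboolPn fN; apply: xgetPN => g gf; apply: fN; exists g.
Qed.

HB.instance Definition _ := GRing.ComNzRing_hasMulInverse.Build laurent
  laurent_mulVr laurent_unitPl laurent_inv_out.

(* Convergence for the t-adic topology, where the t^n A[[t]] form a
   neighbourhood basis of 0. *)
Definition tcvg (u : nat -> laurent) (l : laurent) : Prop :=
  forall n : int, exists N : nat, forall k : nat, (N <= k)%N ->
    forall i : int, i < n -> u k i = l i.

(* l = \prod_(i >= 1) u i *)
Definition is_infprod (u : nat -> laurent) (l : laurent) : Prop :=
  tcvg (fun N => \prod_(1 <= i < N.+1) u i) l.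

(* f = a_0 t^w \prod_(i >= 1) (1 - a_i t^i) \prod_(i >= 1) (1 - a_{-i} t^{-i})
   where a_0 is a unit and the a_{-i} lie in m and almost all vanish. *)
Definition expansion (m : set A) (f : laurent) (w : int) (a : int -> A) : Prop :=
  [/\ a 0 \is a GRing.unit,
      forall i : nat, (0 < i)%N -> m (a (- i%:Z)),
      exists N : nat, forall i : nat, (N < i)%N -> a (- i%:Z) = 0 &
      exists P Q : laurent,
        [/\ is_infprod (fun i => 1 - monom (a i%:Z) i%:Z) P,
            is_infprod (fun i => 1 - monom (a (- i%:Z)) (- i%:Z)) Q &
            f = monom (a 0) w * P * Q]].

(* The expansion is unique when A is artinian local with maximal ideal m and f
   is a unit, so the choice made by xget is then immaterial; the default
   (0, 0) is never reached. *)
Definition the_expansion (m : set A) (f : laurent) : int * (int -> A) :=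
  xget (0, 0) [set wa | expansion m f wa.1 wa.2].

Definition winding (m : set A) (f : laurent) : int := (the_expansion m f).1.

Definition ecoef (m : set A) (f : laurent) : int -> A := (the_expansion m f).2.

Definition contou_carrere (m : set A) (f g : laurent) : A :=
  let a := ecoef m f in let b := ecoef m g in
  let pos := [set i : nat | (0 < i)%N] in
  (-1) ^ (winding m f * winding m g) *
  ((a 0 ^ winding m g *
      \big[*%R/1]_(i \in pos) \big[*%R/1]_(j \in pos)
        (1 - a i%:Z ^+ (j %/ gcdn i j) * b (- j%:Z) ^+ (i %/ gcdn i j))
          ^+ gcdn i j) /
   (b 0 ^ winding m f *
      \big[*%R/1]_(i \in pos) \big[*%R/1]_(j \in pos)
        (1 - a (- i%:Z) ^+ (j %/ gcdn i j) * b j%:Z ^+ (i %/ gcdn i j))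
          ^+ gcdn i j)).

End Laurent.

(* Main.v *)
Require Import Defs.
From HB Require Import structures.
From mathcomp Require Import all_boot all_order all_algebra.
From mathcomp Require Import boolp classical_sets functions cardinality fsbigop.
From mathcomp Require Import qpoly zify ring.

(** The symbol is a quotient of two norms.  Write P for the product of the
    factors 1 - a_i t^i of an expansion and D / t^d for the product of the
    factors 1 - a_(-i) t^(-i), with D monic of degree d.  The norm of
    1 - a t^i modulo t^j - b is (1 - a^(j/d) b^(i/d))^d, d = gcd(i, j)
    ([pnorm_binomial]), so the double products of the symbol of f and g are the
    norms of the plus part of f modulo the polynomial D of g, and conversely;
    the powers of t and the leading coefficients only add more norms.

    Multiply f and g = 1 - f by a large power t^N and truncate: the relation
    f + g = 1 becomes D U + E W = t^N + (high powers of t) with D, E monic and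
    U, W invertible power series, and the theorem becomes an identity between
    N_D(W) and N_E(U) ([steinberg_pnorm]).  Taking norms of the relation modulo
    D and modulo E gives

      N_D(E) N_D(W) = N_D(t)^N   and   N_E(D) N_E(U) = N_E(t)^N,

    where N_D(E) = +- N_E(D) ([pnorm_reciprocity]), while at t = 0 it gives
    D(0) U(0) = - E(0) W(0).  Dividing the two equalities would finish the
    proof, but D(0) and N_D(E) are in general nilpotent.  What survives is that
    the two sides of the identity differ by an element killed by D(0)^N
    ([reciprocity_annihilated]).

    To cancel D(0)^N, replace D by D + s over A[s], keep U, and lift E and W
    to a factorization of t^N - (D + s) U modulo a high power of s
    ([hensel_lift]).  Now D(0) + s takes the place of D(0).  As D(0) is
    nilpotent, D(0) + s divides a power of s, and powers of s can be cancelled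
    in A[s] up to a loss of precision which the choice of the exponent absorbs.
    Setting s = 0 gives the identity over A.

    The remaining point is that units have expansions ([expansion_exists]).  It
    rests on the nilpotency of the maximal ideal ([maximal_nilpotent]), which
    makes both the Weierstrass factorization and the extraction of the factors
    1 - a_(-i) t^(-i) stop after finitely many steps. *)

Set Implicit Arguments.
Unset Strict Implicit.
Unset Printing Implicit Defensive.
Import GRing.Theory.
Import Pdiv.CommonRing Pdiv.RingMonic.
Local Open Scope ring_scope.

(** * Norms of polynomials modulo a monic polynomial *)

Section Norm.
Variable R : comNzRingType.
Implicit Types D P Q S : {poly R}.

(** Multiplication by [P] on R[X]/(D) in the basis of the powers of X, acting on
    row vectors.  The size is that of [D] minus one, so that the trivial
    quotient by [D = 1] gives the empty matrix, of determinant 1. *)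
Definition mulmod_mx D P : 'M[R]_((size D).-1) :=
  \matrix_(i, j) (rmodp (P * 'X^i) D)`_j.

(** The norm of R[X]/(D) over R; for monic [D] it is the resultant of [D] and
    [P]. *)
Definition pnorm D P : R := \det (mulmod_mx D P).

Lemma size_rmodp_monic D P :
  D \is monic -> (size (rmodp P D) <= (size D).-1)%N.
Proof.
move=> mD; rewrite -ltnS prednK ?size_poly_gt0 ?monic_neq0 //.
by rewrite ltn_rmodpN0 ?monic_neq0.
Qed.

Lemma mulmod_mxM D P Q :
  D \is monic -> mulmod_mx D (P * Q) = mulmod_mx D P *m mulmod_mx D Q.
Proof.
move=> mD; apply/matrixP => i j; rewrite !mxE.
set r := rmodp (P * 'X^i) D.
have -> : rmodp (P * Q * 'X^i) D = rmodp (Q * r) D.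
  by rewrite rmodp_mulmr //; congr rmodp; ring.
have -> : r = \sum_(k < (size D).-1) r`_k *: 'X^k.
  rewrite -poly_def; apply/polyP => k; rewrite coef_poly.
  case: ltnP => // kD; rewrite nth_default //.
  exact: leq_trans (size_rmodp_monic _ mD) kD.
rewrite mulr_sumr rmodp_sum // coef_sum; apply: eq_bigr => k _.
by rewrite !mxE -scalerAr rmodpZ // coefZ.
Qed.

Lemma pnormM D P Q : D \is monic -> pnorm D (P * Q) = pnorm D P * pnorm D Q.
Proof. by move=> mD; rewrite /pnorm mulmod_mxM // det_mulmx. Qed.

Lemma pnormC D c : D \is monic -> pnorm D c%:P = c ^+ (size D).-1.
Proof.
move=> mD; rewrite -(det_scalar (size D).-1 c); congr (\det _).
apply/matrixP => i j; rewrite !mxE mul_polyC rmodpZ // rmodp_small.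
  by rewrite coefZ coefXn eq_sym mulr_natr.
by rewrite size_polyXn -ltn_predRL.
Qed.

Lemma pnorm1 D : D \is monic -> pnorm D 1 = 1.
Proof. by move=> mD; rewrite pnormC // expr1n. Qed.

Lemma pnormX D P k : D \is monic -> pnorm D (P ^+ k) = pnorm D P ^+ k.
Proof.
by move=> mD; elim: k => [|k IH]; rewrite ?pnorm1 // !exprS pnormM ?IH.
Qed.

Lemma pnorm_prod D I (r : seq I) (p : pred I) (F : I -> {poly R}) :
  D \is monic ->
  pnorm D (\prod_(i <- r | p i) F i) = \prod_(i <- r | p i) pnorm D (F i).
Proof.
move=> mD; apply: (big_morph (pnorm D)); last exact: pnorm1.
by move=> P Q; apply: pnormM.
Qed.

Lemma pnorm_mod D P Q : D \is monic -> pnorm D (P + D * Q) = pnorm D P.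
Proof.
move=> mD; congr (\det _); apply/matrixP => i j; rewrite !mxE; congr (_`_j).
have -> : (P + D * Q) * 'X^i = P * 'X^i + Q * 'X^i * D by ring.
by rewrite rmodpD // rmodp_mull // addr0.
Qed.

(** The matrix of multiplication by X is the companion matrix, whose
    characteristic polynomial is [D]. *)
Lemma pnorm_XsubC D s :
  D \is monic -> pnorm D ('X - s%:P) = (-1) ^+ (size D).-1 * D.[s].
Proof.
move=> mD; rewrite -[in D.[s]](companionmxK mD) /char_poly.
set n := (size D).-1.
have <- : pnorm D (s%:P - 'X) = (char_poly (companionmx D)).[s].
  rewrite -horner_evalE -det_map_mx; congr (\det _).
  apply/matrixP => i j; rewrite !mxE /= horner_evalE !hornerE hornerMn hornerX.
  rewrite mulrBl mul_polyC -exprS rmodpB // rmodpZ // coefB coefZ.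
  rewrite [rmodp 'X^i D]rmodp_small ?coefXn; last first.
    by rewrite size_polyXn -ltn_predRL.
  rewrite eq_sym mulr_natr; congr (_ - _).
  have sD : size D = n.+1 by rewrite prednK // size_poly_gt0 monic_neq0.
  case: eqP => [iE|iN].
    (* The last row is the only one where a reduction modulo D takes place. *)
    have -> : 'X^(i.+1) = 1 * D + ('X^n - D).
      rewrite mul1r addrCA subrr addr0 iE prednK //.
      exact: leq_ltn_trans (ltn_ord i).
    rewrite rmodp_addl_mul_small // ?coefB ?coefXn ?(ltn_eqF (ltn_ord j)) ?sub0r //.
    rewrite sD ltnS; apply/leq_sizeP => k; rewrite leq_eqVlt => /orP[/eqP <-|nk].
      by rewrite coefB coefXn eqxx -(monicP mD) lead_coefE -/n subrr.
    by rewrite coefB coefXn gtn_eqF // nth_default ?subr0 // sD.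
  rewrite rmodp_small ?coefXn 1?eq_sym // size_polyXn -ltn_predRL.
  have := ltn_ord i; rewrite -[(size D).-1]/n leq_eqVlt => /orP[/eqP iE|]; last first.
    by rewrite -ltn_predRL.
  by case: iN; apply: (congr1 predn iE).
have -> : 'X - s%:P = (-1)%:P * (s%:P - 'X) by rewrite polyCN mulN1r opprB.
by rewrite pnormM // pnormC.
Qed.

(** The norm is a polynomial in the coefficients of its argument, hence
    compatible with congruences modulo any [e]: the determinant of A + xB is a
    polynomial in x, and its values at e and 0 differ by a multiple of e. *)
Lemma pnormDe D P Q (e : R) :
  D \is monic -> exists y, pnorm D (P + e *: Q) = pnorm D P + e * y.
Proof.
move=> mD; pose M := map_mx polyC (mulmod_mx D P) + 'X *: map_mx polyC (mulmod_mx D Q).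
have ME x : pnorm D (P + x *: Q) = (\det M).[x].
  rewrite -horner_evalE -det_map_mx; congr (\det _).
  apply/matrixP => i j; rewrite !mxE /= horner_evalE !hornerE.
  by rewrite mulrDl rmodpD // coefD -scalerAl rmodpZ // coefZ.
have M0 : pnorm D P = (\det M).[0] by rewrite -ME scale0r addr0.
rewrite ME M0.
have /factor_theorem[q qE] : root (\det M - (\det M).[0]%:P) 0.
  by rewrite rootE !hornerE subrr.
exists q.[e]; apply/eqP; rewrite addrC -subr_eq; apply/eqP.
rewrite -[LHS]/((\det M).[e] - (\det M).[0]).
rewrite -[(\det M).[0]](hornerC _ e) -hornerN -hornerD.
by rewrite qE !hornerE mulrC subr0.
Qed.

End Norm.

Lemma rmorph_pnorm (R S : comNzRingType) (phi : {rmorphism R -> S})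
    (D P : {poly R}) :
  D \is monic -> phi (pnorm D P) = pnorm (map_poly phi D) (map_poly phi P).
Proof.
move=> mD.
have sD : size (map_poly phi D) = size D.
  by rewrite size_map_poly_id0 // (monicP mD) rmorph1 oner_neq0.
have mpD : map_poly phi D \is monic by apply: monic_map.
rewrite /pnorm -det_map_mx /mulmod_mx sD; congr (\det _).
apply/matrixP => i j; rewrite !mxE.
have <- : map_poly phi (rmodp (P * 'X^i) D) =
          rmodp (map_poly phi P * 'X^i) (map_poly phi D).
  have <- : map_poly phi (P * 'X^i) = map_poly phi P * 'X^i.
    by rewrite rmorphM /= map_polyXn.
  rewrite [in RHS](rdivp_eq mD (P * 'X^i)) rmorphD rmorphM /= rmodp_addl_mul_small //.
  by rewrite sD (leq_ltn_trans (size_poly _ _)) // ltn_rmodpN0 ?monic_neq0.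
by rewrite coef_map.
Qed.

(** * Roots of monic polynomials and reciprocity *)

(** Adjoin a root by passing to R[X]/(p), in which R embeds because p is monic,
    split off the corresponding linear factor, and iterate.  Identities between
    norms can thus be checked on roots, over any base ring. *)
Lemma monic_splits (R : comNzRingType) (p : {poly R}) :
  p \is monic ->
  exists (S : comNzRingType) (phi : {rmorphism R -> S}) (rs : seq S),
    injective phi /\ map_poly phi p = \prod_(x <- rs) ('X - x%:P).
Proof.
move=> mp; have [n sp] : exists n, size p = n.+1.
  by exists (size p).-1; rewrite prednK // size_poly_gt0 monic_neq0.
elim: n R p mp sp => [|n IH] R p mp sp.
  exists R, idfun, [::]; split; first by [].
  rewrite map_poly_id // big_nil.
  have /size_poly1P[c _ pc] : size p == 1%N by rewrite sp.
  by move: mp; rewrite pc monicE lead_coefC => /eqP->.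
have mk_p : mk_monic p = p by rewrite /mk_monic sp mp.
pose S1 : comNzRingType := {poly %/ p}.
pose phi1 : {rmorphism R -> S1} := qpolyC p.
pose q1 : {rmorphism {poly R} -> S1} := in_qpoly p.
have phi1_inj : injective phi1.
  by move=> a b /(congr1 (fun u : {poly %/ p} => u : {poly R})) /polyC_inj.
have rootp : root (map_poly phi1 p) (q1 'X).
  have -> : map_poly phi1 p = map_poly q1 (map_poly polyC p).
    rewrite -map_poly_comp; apply: eq_map_poly => c /=; apply: val_inj => /=.
    by rewrite mk_p rmodp_small // size_polyC sp; case: eqP.
  rewrite rootE horner_map -/(p \Po 'X) comp_polyXr; apply/eqP.
  by apply: val_inj; rewrite /= mk_p rmodpp.
have /factor_theorem[q qE] := rootp.
have mq : q \is monic by rewrite -(monicMr q (monicXsubC (q1 'X))) -qE monic_map.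
have sq : size q = n.+1.
  have := congr1 (fun u : {poly S1} => size u) qE.
  rewrite size_Mmonic ?monicXsubC ?monic_neq0 // size_XsubC addn2 /=.
  by rewrite size_map_poly_id0 ?(monicP mp) ?rmorph1 ?oner_neq0 // sp => -[].
have [S [phi2 [rs [phi2_inj rsE]]]] := IH S1 q mq sq.
(* q1 'X is the class of X, the root that has just been adjoined. *)
exists S, (phi2 \o phi1 : {rmorphism R -> S}), (phi2 (q1 'X) :: rs); split.
  by move=> a b /phi2_inj /phi1_inj.
rewrite map_poly_comp /= qE rmorphM /= rsE big_cons mulrC; congr (_ * _).
by rewrite rmorphB /= map_polyX map_polyC.
Qed.

Section NormOfSplit.
Variable R : comNzRingType.
Implicit Types (D P : {poly R}) (rs : seq R).

Lemma pnorm_split D rs :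
  D \is monic ->
  pnorm D (\prod_(s <- rs) ('X - s%:P)) =
    (-1) ^+ ((size D).-1 * size rs) * \prod_(s <- rs) D.[s].
Proof.
move=> mD; rewrite pnorm_prod //; elim: rs => [|s rs IH].
  by rewrite !big_nil muln0 mul1r.
rewrite !big_cons IH pnorm_XsubC //= mulnS exprD.
by rewrite mulrACA.
Qed.

Lemma monic_addMXn D P k :
  D \is monic -> (size P < size D + k)%N -> P + D * 'X^k \is monic.
Proof.
move=> mD sP.
have sDk : size (D * 'X^k) = (size D + k)%N.
  by rewrite size_Mmonic ?monic_neq0 ?monicXn // size_polyXn addnS.
by rewrite monicE lead_coefDr ?sDk // lead_coef_Mmonic ?monicXn.
Qed.

End NormOfSplit.

Section NormAtRoots.
Variable R : comNzRingType.
Implicit Types (D P : {poly R}) (rs : seq R).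

(** Adding a multiple of D to P changes neither side, so P may be taken monic;
    over a ring where P splits as well, both sides are the product of all the
    differences of a root of D and a root of P. *)
Lemma pnorm_roots rs P :
  pnorm (\prod_(x <- rs) ('X - x%:P)) P = \prod_(x <- rs) P.[x].
Proof.
set D := \prod_(x <- rs) _.
have mD : D \is monic by apply: monic_prod_XsubC.
pose Q := P + D * 'X^(size P).
have mQ : Q \is monic.
  apply: monic_addMXn => //.
  by rewrite -addn1 addnC leq_add2r size_poly_gt0 monic_neq0.
have -> : pnorm D P = pnorm D Q by rewrite pnorm_mod.
transitivity (\prod_(x <- rs) Q.[x]); last first.
  rewrite !big_seq; apply: eq_bigr => x xrs.
  have Dx : D.[x] = 0.
    by rewrite horner_prod (big_rem x) //= hornerXsubC subrr mul0r.
  by rewrite !hornerE Dx mul0r addr0.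
have [S [phi [ss [phi_inj ssE]]]] := monic_splits mQ.
apply: phi_inj; rewrite rmorph_pnorm // ssE pnorm_split; last exact: monic_map.
have -> : map_poly phi D = \prod_(x <- rs) ('X - (phi x)%:P).
  rewrite rmorph_prod; apply: eq_bigr => x _.
  by rewrite /= rmorphB /= map_polyX map_polyC.
have -> : (size (\prod_(x <- rs) ('X - (phi x)%:P))).-1 = size rs.
  by rewrite -(big_map phi xpredT (fun y => 'X - y%:P)) size_prod_XsubC size_map.
rewrite rmorph_prod.
have -> : \prod_(x <- rs) phi Q.[x] = \prod_(x <- rs) \prod_(s <- ss) (phi x - s).
  apply: eq_bigr => x _; rewrite -horner_map ssE horner_prod.
  by apply: eq_bigr => s _; rewrite !hornerE.
(* The signs of these differences cancel the sign in [pnorm_split]. *)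
have -> : \prod_(s <- ss) (\prod_(x <- rs) ('X - (phi x)%:P)).[s] =
          \prod_(s <- ss) \prod_(x <- rs) (-1 * (phi x - s)).
  apply: eq_bigr => s _; rewrite horner_prod.
  by apply: eq_bigr => x _; rewrite !hornerE mulN1r opprB.
rewrite exchange_big /=.
under eq_bigr => x _ do rewrite big_split /= big_const_seq count_predT iter_mulr_1.
rewrite big_split /= big_const_seq count_predT iter_mulr_1 mulrA -exprM mulnC -exprD.
by rewrite addnn -mul2n exprM sqrrN !expr1n mul1r.
Qed.

End NormAtRoots.

Section NormReciprocity.
Variable R : comNzRingType.
Implicit Types D E P : {poly R}.

Lemma pnorm_mull D E P : D \is monic -> E \is monic ->
  pnorm (D * E) P = pnorm D P * pnorm E P.
Proof.
move=> mD mE.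
have [S [phi [ds [phi_inj dsE]]]] := monic_splits mD.
have [T [psi [es [psi_inj esE]]]] := monic_splits (monic_map phi mE).
have mDE : D * E \is monic by rewrite monicMr.
apply: phi_inj; apply: psi_inj.
rewrite !rmorphM /= !rmorph_pnorm ?monic_map // rmorphM /= rmorphM /= esE dsE.
have -> : map_poly psi (\prod_(x <- ds) ('X - x%:P)) =
          \prod_(x <- map psi ds) ('X - x%:P).
  rewrite big_map rmorph_prod; apply: eq_bigr => x _.
  by rewrite /= rmorphB /= map_polyX map_polyC.
by rewrite -big_cat /= !pnorm_roots big_cat.
Qed.

Lemma pnorm1l P : pnorm 1 P = 1.
Proof.
have := pnorm_roots [::] P; by rewrite !big_nil.
Qed.

Lemma pnorm_polyX P : pnorm 'X P = P.[0].
Proof.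
have := pnorm_roots [:: 0] P.
by rewrite !big_seq1 subr0.
Qed.

Lemma pnorm_polyXn k P : pnorm 'X^k P = P.[0] ^+ k.
Proof.
elim: k => [|k IH]; first by rewrite !expr0 pnorm1l.
by rewrite !exprS pnorm_mull ?monicX ?monicXn // IH pnorm_polyX.
Qed.

(** The symmetry of the resultant: when E splits, the norm of D modulo E is the
    product of the values of D at the roots of E, and these values are, up to
    sign, the norms modulo D of the linear factors of E. *)
Lemma pnorm_reciprocity D E : D \is monic -> E \is monic ->
  pnorm D E = (-1) ^+ ((size D).-1 * (size E).-1) * pnorm E D.
Proof.
move=> mD mE.
have [S [phi [es [phi_inj esE]]]] := monic_splits mE.
apply: phi_inj; rewrite rmorphM rmorph_sign /= !rmorph_pnorm // esE.
rewrite pnorm_roots pnorm_split ?monic_map //.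
have sz (F : {poly R}) : F \is monic -> size (map_poly phi F) = size F.
  by move=> mF; rewrite size_map_poly_id0 // (monicP mF) rmorph1 oner_neq0.
have <- : size es = (size E).-1 by rewrite -(sz E) // esE size_prod_XsubC.
by rewrite sz.
Qed.

End NormReciprocity.

(** * Norms of binomials *)

(** The product on the left is the reciprocal polynomial of the one with roots
    [rs], evaluated at [y]; this form needs no inverse of [y]. *)
Lemma prod_1subM_coef (R : comNzRingType) (rs : seq R) (y : R) :
  \prod_(x <- rs) (1 - x * y) =
  \sum_(k < (size rs).+1) (\prod_(x <- rs) ('X - x%:P))`_k * y ^+ (size rs - k).
Proof.
elim: rs => [|x rs IH].
  by rewrite !big_nil big_ord1 coefC mulr1.
rewrite !big_cons IH /=; set p := \prod_(x <- rs) _; set n := size rs.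
have pn1 : p`_n.+1 = 0 by rewrite nth_default // size_prod_XsubC.
under [in RHS]eq_bigr => k _ do rewrite mulrBl coefB coefXM coefCM mulrBl.
rewrite sumrB [X in _ = X - _]big_ord_recl /= mul0r add0r.
rewrite [X in _ = _ - X]big_ord_recr /= pn1 mulr0 mul0r addr0 mulrBl mul1r; congr (_ - _).
rewrite mulr_sumr; apply: eq_bigr => k _ /=.
by rewrite subSn -1?ltnS // exprS; ring.
Qed.

Lemma prod_1subM (R : comNzRingType) (rs : seq R) (a y : R) n :
  (0 < n)%N -> \prod_(x <- rs) ('X - x%:P) = 'X^n - a%:P ->
  \prod_(x <- rs) (1 - x * y) = 1 - a * y ^+ n.
Proof.
move=> n_gt0 rsE.
have szrs : size rs = n.
  by apply: succn_inj; rewrite -(size_XnsubC a n_gt0) -rsE size_prod_XsubC.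
rewrite prod_1subM_coef rsE szrs; case: n n_gt0 {rsE szrs} => // n _.
rewrite big_ord_recl big_ord_recr big1 /= => [|k _].
  rewrite !coefB !coefXn !coefC /= eqxx /bump /= add1n subnn subn0.
  ring.
rewrite coefB coefXn coefC /= /bump /= add1n eqSS ltn_eqF ?subr0 ?mul0r //.
Qed.

Section Binomial.
Variable R : comNzRingType.
Implicit Types a b : R.

(** Over a ring where X^i - a and X^j - b split with roots x and s, both sides
    are the product of the 1 - x s, which is symmetric. *)
Lemma pnorm_binomial_sym i j a b : (0 < i)%N -> (0 < j)%N ->
  pnorm ('X^j - b%:P) (1 - a *: 'X^i) = pnorm ('X^i - a%:P) (1 - b *: 'X^j).
Proof.
move=> i0 j0.
have [S [phi [rs [phi_inj rsE]]]] := monic_splits (monicXnsubC a i0).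
have [T [psi [ss [psi_inj ssE]]]] := monic_splits (monic_map phi (monicXnsubC b j0)).
apply: phi_inj; apply: psi_inj; rewrite !rmorph_pnorm ?monic_map ?monicXnsubC //.
have mapB n c : map_poly psi (map_poly phi ('X^n - c%:P)) = 'X^n - (psi (phi c))%:P.
  by rewrite !rmorphB /= !map_polyXn !map_polyC.
have map1 n c : map_poly psi (map_poly phi (1 - c *: 'X^n)) = 1 - psi (phi c) *: 'X^n.
  by rewrite !rmorphB /= !rmorph1 -!mul_polyC !rmorphM /= !map_polyXn !map_polyC.
have rsE' : \prod_(x <- map psi rs) ('X - x%:P) = 'X^i - (psi (phi a))%:P.
  rewrite -mapB rsE big_map rmorph_prod; apply: eq_bigr => x _.
  by rewrite /= rmorphB /= map_polyX map_polyC.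
rewrite !map1 ssE mapB pnorm_roots -rsE' pnorm_roots.
have ssE' := etrans (esym ssE) (mapB j b).
transitivity (\prod_(s <- ss) \prod_(x <- map psi rs) (1 - x * s)).
  by apply: eq_bigr => s _; rewrite (prod_1subM _ i0 rsE') !hornerE ?hornerXn.
rewrite exchange_big; apply: eq_bigr => x _ /=.
rewrite !hornerE ?hornerXn -(prod_1subM x j0 ssE').
by apply: eq_bigr => s _; rewrite mulrC.
Qed.

Lemma pnorm_binomial_red i j a b : (0 < j)%N ->
  pnorm ('X^j - b%:P) (1 - a *: 'X^(i + j)) = pnorm ('X^j - b%:P) (1 - (a * b) *: 'X^i).
Proof.
move=> j0.
rewrite -(@pnorm_mod _ _ (1 - (a * b) *: 'X^i) (- (a *: 'X^i))) ?monicXnsubC //.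
congr pnorm; rewrite exprD -!mul_polyC polyCM; ring.
Qed.

(** Euclid's algorithm on the exponents: X^j = b modulo X^j - b lowers i by j
    at the price of replacing a by a b, and the symmetry exchanges the two
    exponents.  The right-hand side follows the same rules. *)
Lemma pnorm_binomial i j a b : (0 < i)%N -> (0 < j)%N ->
  pnorm ('X^j - b%:P) (1 - a *: 'X^i) =
  (1 - a ^+ (j %/ gcdn i j) * b ^+ (i %/ gcdn i j)) ^+ gcdn i j.
Proof.
have [n leij] := ubnP (i + j)%N; elim: n => // n IH in i j a b leij *.
wlog leji : i j a b leij / (j <= i)%N => [wl | i0 j0].
  case: (leqP j i) => [ji|/ltnW ij] i0 j0; first exact: wl.
  by rewrite pnorm_binomial_sym // gcdnC mulrC wl // addnC.
rewrite -(subnK leji); set k := (i - j)%N.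
have kij : (i = k + j)%N by rewrite subnK.
have -> : gcdn (k + j) j = gcdn k j by rewrite gcdnC gcdnDr gcdnC.
rewrite pnorm_binomial_red //.
have [k0|k0] := posnP k.
  rewrite k0 gcd0n add0n divnn j0 !expr1 expr0 alg_polyC -polyC1 -polyCB.
  by rewrite pnormC ?monicXnsubC // size_XnsubC.
rewrite IH //; last by lia.
rewrite divnDr ?dvdn_gcdr // exprMn exprD; congr ((1 - _) ^+ _); ring.
Qed.

End Binomial.

(** * Lifting factorizations and the three-term relation *)

Lemma poly0_factorX (R : nzRingType) (p : {poly R}) :
  p.[0] = 0 -> exists q, p = q * 'X.
Proof.
move=> p0; have /factor_theorem[q ->] : root p 0 by apply/rootP.
by exists q; rewrite subr0.
Qed.

Lemma poly_inv_modXn (A : comUnitRingType) (W : {poly A}) L :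
  W.[0] \is a GRing.unit -> exists V T, W * V = 1 + 'X^L * T.
Proof.
move=> W0; elim: L => [|L [V [T WV]]].
  by exists 0, (-1); rewrite mulr0 expr0 mul1r subrr.
have [|T' T'E] := @poly0_factorX _ (T - W * (T.[0] / W.[0])%:P).
  by rewrite hornerD hornerN hornerM hornerC mulrCA divrr // mulr1 subrr.
exists (V - 'X^L * (T.[0] / W.[0])%:P), T'.
transitivity (W * V - 'X^L * (W * (T.[0] / W.[0])%:P)); first by ring.
rewrite WV exprSr -mulrA ['X * T']mulrC -T'E; ring.
Qed.

Section Hensel.
Variable R : comNzRingType.

(** A factorization E W of H modulo s and X^L, with E monic and W invertible
    modulo X^L (with inverse V), lifts to one modulo s^(M+1) and X^L.  A defect
    s^M h is removed by corrections of E and W with h = rho W + E (W q); they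
    are found by dividing h V by E, and the remainder rho has degree less than
    that of E, so E stays monic. *)
Lemma hensel_lift (s : R) (L : nat) (E W V T H h0 y0 : {poly R}) (M : nat) :
  E \is monic -> W * V = 1 + 'X^L * T ->
  E * W = H + s%:P * h0 + 'X^L * y0 ->
  exists E' W' e w h y : {poly R},
    [/\ E' \is monic, E' = E + s%:P * e, W' = W + s%:P * w &
        E' * W' = H + s%:P ^+ M.+1 * h + 'X^L * y].
Proof.
move=> mE WV EW.
(* The size of E' is needed by the induction only. *)
suff [E' [W' [e [w [h [y [mE' sE' E'E W'E E'W']]]]]]] :
    exists E' W' e w h y : {poly R},
    [/\ E' \is monic, size E' = size E, E' = E + s%:P * e, W' = W + s%:P * w &
        E' * W' = H + s%:P ^+ M.+1 * h + 'X^L * y].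
  by exists E', W', e, w, h, y.
elim: M => [|M [E' [W' [e [w [h [y [mE' sE' E'E W'E E'W']]]]]]]].
  exists E, W, 0, 0, h0, y0; split=> //; rewrite ?mulr0 ?addr0 //.
set q := rdivp (h * V) E; set rho := rmodp (h * V) E.
have hV : h * V = q * E + rho by apply: rdivp_eq.
set S := s%:P ^+ M.+1.
have szr : (size (- (S * rho))%R < size E')%N.
  rewrite size_polyN sE' /S -rmorphXn /= mul_polyC.
  rewrite (leq_ltn_trans (size_scale_leq _ _)) //.
  by rewrite ltn_rmodpN0 // monic_neq0.
exists (E' - S * rho), (W' - S * (W * q)).
exists (e - s%:P ^+ M * rho), (w - s%:P ^+ M * (W * q)).
exists (- (rho * w + e * W * q) + s%:P ^+ M * rho * W * q), (y - S * (h * T)).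
split.
- by rewrite monicE lead_coefDl // (monicP mE').
- by rewrite size_polyDl.
- by rewrite E'E /S exprS; ring.
- by rewrite W'E /S exprS; ring.
(* The corrections cancel the defect, up to multiples of X^L. *)
have key : rho * W + E * W * q = h + 'X^L * (h * T).
  transitivity (W * (h * V)); first by rewrite hV; ring.
  by rewrite mulrCA WV; ring.
transitivity (E' * W' - S * (rho * W' + E' * W * q) + S * S * rho * W * q); first by ring.
rewrite E'W'.
have -> : rho * W' + E' * W * q = h + 'X^L * (h * T) + s%:P * (rho * w + e * W * q).
  by rewrite -key W'E E'E; ring.
rewrite -/S [s%:P ^+ M.+2]exprS -/S {3}/S exprS; ring.
Qed.

End Hensel.

Section ThreeTerms.
Variable R : comNzRingType.
Implicit Types D E U W P h : {poly R}.

(** The relation D U + E W = X^N P modulo e turns, modulo D, into an equality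
    between E W and X^N P; the power of X contributes the power of the norm of
    X, which is D(0) up to sign. *)
Lemma pnorm_three_terms D E U W P h (e : R) N :
  D \is monic -> D * U + E * W = 'X^N * P + e%:P * h ->
  exists z, pnorm D E * pnorm D W =
    (-1) ^+ ((size D).-1 * N) * D.[0] ^+ N * pnorm D P + e * z.
Proof.
move=> mD eqD.
have [z zE] := pnormDe ('X^N * P) h e mD.
exists z; rewrite -pnormM //.
have -> : E * W = 'X^N * P + e *: h + D * (- U).
  by rewrite -mul_polyC -eqD; ring.
rewrite pnorm_mod // zE pnormM // pnormX //.
have -> : pnorm D 'X = (-1) ^+ (size D).-1 * D.[0].
  by rewrite -pnorm_XsubC // subr0.
by rewrite exprMn -exprM.
Qed.

Lemma exprDe (x e z : R) N : exists z', (x + e * z) ^+ N = x ^+ N + e * z'.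
Proof.
elim: N => [|N [z' IH]]; first by exists 0; rewrite !expr0 mulr0 addr0.
exists (z * x ^+ N + x * z' + e * z * z'); rewrite !exprS IH; ring.
Qed.

(** Combine the two equalities of [pnorm_three_terms], modulo D and modulo E,
    with reciprocity.  They show that N_D(E) times the difference below is 0
    modulo e.  As N_D(E) may be a zero divisor, it is not cancelled but replaced
    by its multiple D(0)^N N_D(P). *)
Lemma reciprocity_annihilated D E U W P h (e : R) N :
  let n := (size D).-1 in let n' := (size E).-1 in
  D \is monic -> E \is monic -> (0 < N)%N ->
  D * U + E * W = 'X^N * P + e%:P * h ->
  exists z, D.[0] ^+ N * U.[0] ^+ N * pnorm D P * pnorm E P *
    ((-1) ^+ (n * N) * pnorm D W * pnorm E P * U.[0] ^+ N -
     (-1) ^+ (n * n' + n' * N + N) * pnorm E U * pnorm D P * W.[0] ^+ N) = e * z.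
Proof.
move=> n n' mD mE N0 eqDE.
have [z1 F1] := pnorm_three_terms mD eqDE.
have eqED : E * W + D * U = 'X^N * P + e%:P * h by rewrite addrC.
have [z2 F2] := pnorm_three_terms mE eqED.
have F3 := pnorm_reciprocity mD mE.
(* At X = 0 the term X^N P disappears, since N > 0. *)
have [z4 F4] : exists z, E.[0] ^+ N * W.[0] ^+ N =
    (-1) ^+ N * (D.[0] ^+ N * U.[0] ^+ N) + e * z.
  have eq0 : D.[0] * U.[0] + E.[0] * W.[0] = e * h.[0].
    have := congr1 (fun p => p.[0]) eqDE.
    by rewrite /= !hornerD !hornerM hornerXn expr0n gtn_eqF // mul0r add0r hornerC.
  have [z zE] := exprDe (- (D.[0] * U.[0])) e h.[0] N.
  exists z; transitivity ((- (D.[0] * U.[0]) + e * h.[0]) ^+ N).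
    by rewrite -exprMn -eq0; congr (_ ^+ _); ring.
  by rewrite zE [(- (_ * _)) ^+ N]exprNn exprMn.
rewrite !exprD; move: F1 F2 F3 F4; rewrite -/n -/n'.
set r := pnorm D E; set r' := pnorm E D.
set NW := pnorm D W; set NU := pnorm E U; set k1 := pnorm D P; set k2 := pnorm E P.
set p := (-1) ^+ (n * N); set q := (-1) ^+ (n' * N); set t := (-1) ^+ (n * n').
set v := (-1) ^+ N; set dN := D.[0] ^+ N; set uN := U.[0] ^+ N.
set d'N := E.[0] ^+ N; set wN := W.[0] ^+ N => F1 F2 F3 F4.
have sgn k : ((-1) ^+ k * (-1) ^+ k = 1 :> R) by rewrite -exprMn mulrNN mulr1 expr1n.
have pp : p * p = 1 := sgn _.
have qq : q * q = 1 := sgn _.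
have tt : t * t = 1 := sgn _.
have vv : v * v = 1 := sgn _.
set Z := _ - _.
have rZ : r * Z = e * (p * k2 * uN * z1 - v * k1 * k2 * z4 - q * v * k1 * wN * z2).
  transitivity (p * k2 * uN * (r * NW) - t * q * v * k1 * wN * (r * NU)); first by rewrite /Z; ring.
  rewrite F1 F3.
  transitivity (p * p * (k1 * k2 * uN * dN) + e * (p * k2 * uN * z1)
     - (t * t) * q * v * k1 * wN * (r' * NU)); first by ring.
  rewrite F2 pp tt.
  transitivity (k1 * k2 * uN * dN + e * (p * k2 * uN * z1) - (q * q) * v * k1 * k2 * (d'N * wN)
    - e * (q * v * k1 * wN * z2)); first by ring.
  rewrite F4 qq.
  transitivity (k1 * k2 * uN * dN + e * (p * k2 * uN * z1) - (v * v) * (k1 * k2 * uN * dN)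
    - e * (v * k1 * k2 * z4) - e * (q * v * k1 * wN * z2)); first by ring.
  rewrite vv; ring.
exists (uN * k2 * p * NW * (p * k2 * uN * z1 - v * k1 * k2 * z4 - q * v * k1 * wN * z2)
        - uN * k2 * p * z1 * Z).
have dE : dN * k1 = p * (r * NW - e * z1).
  rewrite F1; transitivity (p * p * (dN * k1)); last by ring.
  by rewrite pp mul1r.
transitivity (uN * k2 * (dN * k1) * Z); first by ring.
rewrite dE.
transitivity (uN * k2 * p * NW * (r * Z) - e * (uN * k2 * p * z1 * Z)); first by ring.
rewrite rZ; ring.
Qed.

End ThreeTerms.

(** * The norm form of the Steinberg relation *)

Section Deformation.
Variable A : comUnitRingType.
Implicit Types D E U W : {poly A}.

Lemma pnorm_1DXn D P C k :
  D \is monic -> D * C = 'X^k -> pnorm D (1 + 'X^k * P) = 1.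
Proof. by move=> mD <-; rewrite -mulrA pnorm_mod // pnorm1. Qed.

(** A power of X is divisible by D, so the norm of X, which is D(0) up to sign,
    is nilpotent as soon as D has positive degree. *)
Lemma nilp_root0 D C k :
  D \is monic -> (1 < size D)%N -> D * C = 'X^k -> D.[0] ^+ k = 0.
Proof.
move=> mD sD DC.
have : pnorm D 'X ^+ k = 0.
  rewrite -pnormX // -DC -[D * C]add0r pnorm_mod // -polyC0 pnormC //.
  by rewrite expr0n -subn1 subn_eq0 leqNgt sD.
have -> : pnorm D 'X = (-1) ^+ (size D).-1 * D.[0].
  by rewrite -pnorm_XsubC // subr0.
rewrite exprMn -exprM => /(congr1 ( *%R ((-1) ^+ ((size D).-1 * k)))).
by rewrite mulr0 mulrA -exprMn mulrNN mulr1 expr1n mul1r.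
Qed.

Local Notation "p ^C" := (map_poly polyC p).

(** Polynomials over A[s] are specialized at s = 0; s is the variable of the
    inner polynomial ring. *)
Let ev0 : {rmorphism {poly A} -> A} := horner_eval 0.

Lemma ev0_polyC p : map_poly ev0 p^C = p.
Proof.
rewrite -map_poly_comp /=; apply: map_poly_id => c _ /=.
exact: hornerC.
Qed.

Lemma ev0_XM p : map_poly ev0 (('X : {poly A})%:P * p) = 0.
Proof. by rewrite rmorphM /= map_polyC /= horner_evalE hornerX mul0r. Qed.

(** The Steinberg relation for norms.  That D and E divide X^k expresses that
    they are powers of X modulo nilpotents, and makes the term X^(N+k) Y
    invisible to both norms.  The proof deforms D to D + s over A[s] in order
    to turn the nilpotent D(0) into D(0) + s, which divides a power of s. *)
Lemma steinberg_pnorm D E U W Y C C' N k :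
  let n := (size D).-1 in let n' := (size E).-1 in
  D \is monic -> (1 < size D)%N -> E \is monic -> (0 < N)%N ->
  D * C = 'X^k -> E * C' = 'X^k ->
  U.[0] \is a GRing.unit -> W.[0] \is a GRing.unit ->
  D * U + E * W = 'X^N + 'X^(N + k) * Y ->
  (-1) ^+ (n * N) * pnorm D W * U.[0] ^+ N =
  (-1) ^+ (n * n' + n' * N + N) * pnorm E U * W.[0] ^+ N.
Proof.
move=> n n' mD sD mE N0 DC EC U0 W0 eqDE.
pose s : {poly A} := 'X.
have [V [T WV]] := poly_inv_modXn (N + k) W0.
have WV' : W^C * V^C = 1 + 'X^(N + k) * T^C.
  by rewrite -rmorphM WV rmorphD rmorphM /= rmorph1 map_polyXn.
pose Ds := D^C + s%:P.
have EW : E^C * W^C = ('X^N - Ds * U^C) + s%:P * U^C + 'X^(N + k) * Y^C.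
  have : D^C * U^C + E^C * W^C = 'X^N + 'X^(N + k) * Y^C.
    by rewrite -!rmorphM -rmorphD eqDE rmorphD rmorphM /= !map_polyXn.
  by move=> eqC; rewrite -[LHS](addKr (D^C * U^C)) eqC /Ds; ring.
have mEC : E^C \is monic by apply: monic_map.
(* The precision k N + 1 exceeds by one the power of s that has to be cancelled:
   s^k is a multiple of D(0) + s, and (D(0) + s)^N is to be removed. *)
have [Es [Ws [e [w [h [y [mEs EsE WsE EsWs]]]]]]] := hensel_lift (k * N) mEC WV' EW.
have mDs : Ds \is monic.
  rewrite monicE lead_coefDl ?lead_coef_map_inj //; first by rewrite (monicP mD).
    exact: polyC_inj.
  rewrite size_polyC size_map_inj_poly //; last exact: polyC_inj.
  by rewrite (leq_ltn_trans (leq_b1 _)).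
have eqs : Ds * U^C + Es * Ws = 'X^N * (1 + 'X^k * y) + (s ^+ (k * N).+1)%:P * h.
  by rewrite EsWs exprD rmorphXn /=; ring.
have [z zE] := reciprocity_annihilated mDs mEs N0 eqs.
set kap := pnorm Ds _ in zE; set kap' := pnorm Es (1 + _) in zE.
move: zE; set Z := (_ - _) => zE.
have DsE : map_poly ev0 Ds = D.
  by rewrite rmorphD /= ev0_polyC map_polyC /= horner_evalE hornerX addr0.
have EsE' : map_poly ev0 Es = E by rewrite EsE rmorphD /= ev0_polyC ev0_XM addr0.
have WsE' : map_poly ev0 Ws = W by rewrite WsE rmorphD /= ev0_polyC ev0_XM addr0.
have PE : map_poly ev0 (1 + 'X^k * y) = 1 + 'X^k * map_poly ev0 y.
  by rewrite rmorphD rmorphM rmorph1 /= map_polyXn.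
have ev0kap : ev0 kap = 1 by rewrite rmorph_pnorm // DsE PE (pnorm_1DXn _ mD DC).
have ev0kap' : ev0 kap' = 1 by rewrite rmorph_pnorm // EsE' PE (pnorm_1DXn _ mE EC).
have Ds0 : Ds.[0] = 'X + (D.[0])%:P.
  by rewrite hornerD hornerC -[0 in LHS]polyC0 horner_map addrC.
have U0E : U^C.[0] = (U.[0])%:P by rewrite -[0 in LHS]polyC0 horner_map.
(* s^k = s^k - (- D(0))^k, which is divisible by s + D(0). *)
have [g gE] : exists g, 'X^k = Ds.[0] * g.
  exists (\sum_(i < k) 'X ^+ (k.-1 - i) * (- (D.[0])%:P) ^+ i).
  have := subrXX 'X (- (D.[0])%:P) k; rewrite opprK -Ds0 => <-.
  by rewrite exprNn -rmorphXn /= (nilp_root0 mD sD DC) polyC0 mulr0 subr0.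
have ev0Z : ev0 Z = 0.
  have XX : 'X^(k * N) * ((U.[0])%:P ^+ N * kap * kap' * Z) =
            'X^(k * N) * ('X * (g ^+ N * z)).
    transitivity (g ^+ N * (Ds.[0] ^+ N * U^C.[0] ^+ N * kap * kap' * Z)).
      rewrite exprM gE exprMn U0E; ring.
    rewrite zE exprS /s; ring.
  have /(congr1 ev0) := monic_lreg (monicXn A (k * N)) XX.
  rewrite !rmorphM /= rmorphXn /= ev0kap ev0kap' !mulr1.
  rewrite [ev0 'X]horner_evalE hornerX mul0r => /(congr1 ( *%R ((U.[0] ^+ N)^-1))).
  have -> : ev0 (U.[0])%:P = U.[0] by rewrite /= horner_evalE hornerC.
  by rewrite mulrA mulVr ?unitrX // mul1r mulr0.
have szDs : size Ds = size D.
  by rewrite -DsE size_map_poly_id0 // (monicP mDs) rmorph1 oner_neq0.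
have szEs : size Es = size E.
  by rewrite -EsE' size_map_poly_id0 // (monicP mEs) rmorph1 oner_neq0.
apply/eqP; rewrite -subr_eq0 -[X in _ == X]ev0Z /Z rmorphB !rmorphM !rmorph_sign /=.
rewrite ev0kap ev0kap' !mulr1 !rmorphXn /= !rmorph_pnorm // DsE EsE' WsE' ev0_polyC.
have -> : ev0 U^C.[0] = U.[0] by rewrite U0E /= horner_evalE hornerC.
have -> : ev0 Ws.[0] = W.[0] by rewrite -[ev0 _]horner_map /= rmorph0 WsE'.
by rewrite szDs szEs.
Qed.

End Deformation.

(** * Nilpotency of the maximal ideal *)

Import Order.TTheory Num.Theory.
Local Open Scope classical_set_scope.

Section Ideals.
Variable A : comUnitRingType.
Implicit Types (I J m : set A) (x y : A).

Lemma idealN I x : ideal I -> I x -> I (- x).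
Proof. by case=> _ _ IM Ix; rewrite -mulN1r; apply: IM. Qed.

Lemma ideal_sum I (T : Type) (r : seq T) (P : pred T) (F : T -> A) :
  ideal I -> (forall i, P i -> I (F i)) -> I (\sum_(i <- r | P i) F i).
Proof. by case=> I0 ID _ IF; apply: (big_ind I). Qed.

Lemma ideal_principal x : ideal [set y | exists a, y = a * x].
Proof.
split=> [|y z [a ->] [b ->]|a y [b ->]].
- by exists 0; rewrite mul0r.
- by exists (a + b); rewrite mulrDl.
- by exists (a * b); rewrite mulrA.
Qed.

(** Zorn's lemma for the proper ideals containing x; the empty set is admitted
    as well, because it is the union of the empty chain. *)
Lemma nonunit_sub_maximal x :
  x \isn't a GRing.unit -> exists2 m, maximal_ideal m & m x.
Proof.
move=> xN; pose good J := J = set0 \/ [/\ ideal J, J x & ~ J 1].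
have [F Fgood Ftot|m [goodm maxm]] := @Zorn_bigcup A good.
  have [[J0 FJ0 J0x]|noJ] := pselect (exists2 J, F J & J x); last first.
    left; rewrite -subset0 => y [J FJ Jy].
    case: (Fgood _ FJ) => [JE|[_ Jx _]]; first by rewrite JE in Jy.
    by case: noJ; exists J.
  have idF J y : F J -> J y -> ideal J.
    by move=> FJ Jy; case: (Fgood _ FJ) => [JE|[]//]; rewrite JE in Jy.
  right; split; [split| |].
  - by exists J0 => //; case: (idF _ _ FJ0 J0x).
  - move=> y z [J FJ Jy] [K FK Kz].
    case: (Ftot _ _ FJ FK) => sub.
      exists K => //; case: (idF _ _ FK Kz) => _ D _; apply: D => //; exact: sub.
    exists J => //; case: (idF _ _ FJ Jy) => _ D _; apply: D => //; exact: sub.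
  - move=> a y [J FJ Jy]; exists J => //.
    by case: (idF _ _ FJ Jy) => _ _; apply.
  - by exists J0.
  - move=> [J FJ J1]; case: (Fgood _ FJ) => [JE|[_ _ //]].
    by rewrite JE in J1.
have goodx : good [set y | exists a, y = a * x].
  right; split; first exact: ideal_principal.
    by exists 1; rewrite mul1r.
  move=> [a a1]; move/negP: xN; apply; apply/unitrPr; exists a.
  by rewrite mulrC.
have {}goodm : [/\ ideal m, m x & ~ m 1].
  case: goodm => // m0; have /maxm[] := goodx; split.
    by rewrite m0; apply: sub0set.
  by rewrite m0; move=> /(_ x); apply; exists 1; rewrite mul1r.
case: goodm => im mx m1; exists m => //; split=> // J iJ J1 mJ.
apply: contrapT => Jm; apply: (maxm J); last by right; split=> //; apply: mJ.
by split=> // Jsub; apply: Jm; apply/seteqP; split.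
Qed.

(** The power m^k, as the intersection of the ideals that contain the products
    of an element of m and an element of m^(k-1). *)
Fixpoint idealX m (k : nat) : set A :=
  if k is k'.+1 then
    [set x | forall I, ideal I ->
      (forall y z, m y -> idealX m k' z -> I (y * z)) -> I x]
  else setT.

Lemma ideal_idealX m k : ideal (idealX m k).
Proof.
case: k => [|k]; first by split.
split=> [I [] //|x y Ix Iy I iI sI|a x Ix I iI sI]; case: (iI) => _ ID IM.
  by apply: ID; [apply: Ix|apply: Iy].
by apply: IM; apply: Ix.
Qed.

Lemma idealX_mul m k y z : m y -> idealX m k z -> idealX m k.+1 (y * z).
Proof. by move=> my Jz I iI; apply. Qed.

Lemma sub_idealX1 m x : m x -> idealX m 1 x.
Proof. by move=> mx; rewrite -[x]mulr1; apply: idealX_mul. Qed.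

Lemma idealX1_sub m x : ideal m -> idealX m 1 x -> m x.
Proof.
by move=> im; apply => // y z my _; rewrite mulrC; case: im => _ _; apply.
Qed.

Lemma idealXM m k l x y :
  idealX m k x -> idealX m l y -> idealX m (k + l) (x * y).
Proof.
elim: k x => [|k IH] x Jx Jy.
  by case: (ideal_idealX m l) => _ _; apply.
have [J0 JD JM] := ideal_idealX m (k.+1 + l).
apply: (Jx [set u | idealX m (k.+1 + l) (u * y)]) => /= [|u z mu Jz].
  split=> [|u v|a u] /=; rewrite ?mul0r // ?mulrDl -?mulrA.
    exact: JD.
  exact: JM.
by rewrite -mulrA; apply: idealX_mul => //; apply: IH.
Qed.

Lemma idealX_le m k l x : (k <= l)%N -> idealX m l x -> idealX m k x.
Proof.
move=> /subnK <-; elim: (l - k)%N x => // d IH x Jx; apply: IH.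
apply: (Jx _ (ideal_idealX m (d + k))) => y z _ Jz.
by case: (ideal_idealX m (d + k)) => _ _; apply.
Qed.

Lemma idealX_exp m k x : m x -> idealX m k (x ^+ k).
Proof.
by move=> mx; elim: k => // k IH; rewrite exprS; apply: idealX_mul.
Qed.

End Ideals.

Section ArtinLocal.
Variables (A : comUnitRingType) (m : set A).
Hypotheses (Aart : artinian A) (Aloc : is_local_with m).

Lemma local_ideal : ideal m. Proof. by case: Aloc => [[]]. Qed.

Lemma local_proper : ~ m 1. Proof. by case: Aloc => [[]]. Qed.

Lemma local_unit x : ~ m x -> x \is a GRing.unit.
Proof.
move=> mx; apply: contrapT => /negP /nonunit_sub_maximal [m' mm' m'x].
by apply: mx; case: Aloc => _ /(_ _ mm') <-.
Qed.

Lemma local_unit_1sub x : m x -> 1 - x \is a GRing.unit.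
Proof.
move=> mx; apply: local_unit => m1x; apply: local_proper.
by rewrite -(subrK x 1); case: local_ideal => _ D _; apply: D.
Qed.

(** The powers of m stabilize at some m^e.  Suppose that an ideal K is not
    killed by m^e: some x in K is not.  Then x m is an ideal inside K which is
    not killed by m^e either, as m^e = m^(e+1); and it is strictly smaller,
    since x = x y with y in m would give x (1 - y) = 0 and x = 0.  Iterating
    from K = A contradicts the descending chain condition. *)
Lemma maximal_nilpotent : exists e, forall x, idealX m e x -> x = 0.
Proof.
have [e Je] := Aart (ideal_idealX m) (fun n x => idealX_le (leqnSn n)).
exists e; apply: contrapT => nJe.
pose bad (K : set A) := ideal K /\ exists x z, [/\ K x, idealX m e z & x * z <> 0].
have badT : bad setT.
  split; first by split.
  have /existsNP[z /not_implyP[Jz z0]] := nJe.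
  by exists 1, z; split=> //; rewrite mul1r.
have shrink (K : {K | bad K}) : exists K' : {K | bad K}, sval K' `<` sval K.
  case: K => K /= [iK [x [z [Kx Jz xz]]]].
  pose K' : set A := [set u | exists2 y, m y & u = x * y].
  have [m0 mD mM] := local_ideal.
  have iK' : ideal K'.
    split=> [|u v [y my ->] [y' my' ->]|a u [y my ->]].
    - by exists 0; rewrite ?mulr0.
    - by exists (y + y'); rewrite ?mulrDr //; apply: mD.
    - by exists (a * y); [apply: mM|rewrite mulrCA].
  have badK' : bad K'.
    split=> //; apply: contrapT => nbad; apply: xz.
    move: Jz; rewrite -(Je e.+1) // => Jz.
    apply: (Jz [set u | x * u = 0]) => /= [|y z' my Jz'].
      split=> [|u v|a u] /=; first by rewrite mulr0.
        by move=> xu xv; rewrite mulrDr xu xv addr0.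
      by move=> xu; rewrite mulrCA xu mulr0.
    rewrite mulrA; apply: contrapT => xyz; apply: nbad.
    by exists (x * y), z'; split=> //; exists y.
  exists (exist _ K' badK'); split=> /= [u [y my ->]|sub].
    by rewrite mulrC; case: iK => _ _; apply.
  have [y my xy] := sub x Kx; apply: xz.
  have : x * (1 - y) = 0 by rewrite mulrBr mulr1 -xy subrr.
  move=> /(congr1 ( *%R^~ (1 - y)^-1)); rewrite mulrK ?local_unit_1sub // mul0r => ->.
  by rewrite mul0r.
have [next nextP] := choice shrink.
pose K n := sval (iter n next (exist _ setT badT)).
have [N KN] : exists N, forall n, (N <= n)%N -> K n = K N.
  apply: Aart => [n|n]; first by rewrite /K; case: (iter _ _ _) => ? [].
  by case: (nextP (iter n next (exist _ setT badT))).
case: (nextP (iter N next (exist _ setT badT))) => _; apply.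
by rewrite -[sval (next _)]/(K N.+1) KN.
Qed.

End ArtinLocal.

(** * Calculus of Laurent series *)

Section LaurentCalculus.
Variable A : comUnitRingType.
Implicit Types (f g h u v : laurent A) (a b : A) (i j n N M : int).

Definition vanish_lt N f := forall i, i < N -> f i = 0.
Definition vanish_gt N f := forall i, N < i -> f i = 0.

Lemma coef_laurentM f g n : (f * g) n = mul_coef f g n.
Proof. by []. Qed.

Lemma laurentB f g n : (f - g) n = f n - g n.
Proof. by []. Qed.

Lemma laurent1 n : (1 : laurent A) n = (n == 0)%:R.
Proof. by rewrite /= ; case: eqP. Qed.

Lemma laurent_sum (T : Type) (r : seq T) (P : pred T) (F : T -> laurent A) n :
  (\sum_(i <- r | P i) F i) n = \sum_(i <- r | P i) F i n.
Proof. by apply: (big_morph (fun f : laurent A => f n)). Qed.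

Lemma ideal_coefM I f g n :
  ideal I -> (forall i, I (f i * g (n - i))) -> I ((f * g) n).
Proof. by move=> iI If; apply: ideal_sum. Qed.

Lemma coef_monomM a k f n : (monom a k * f) n = a * f (n - k).
Proof.
rewrite coef_laurentM /mul_coef (fsbigE [:: k]) //= => [|i _].
  by rewrite big_cons big_nil in_setT eqxx addr0.
by rewrite inE => /negPf->; rewrite mul0r.
Qed.

Lemma monomM a b k n : monom a k * monom b n = monom (a * b) (k + n).
Proof.
apply: laurentP => i; rewrite coef_monomM /= subr_eq [n + k]addrC.
by case: eqP; rewrite ?mulr0.
Qed.

Lemma monom0 n : monom (0 : A) n = 0.
Proof. by apply: laurentP => i /=; case: eqP. Qed.

Lemma monomX a n (k : nat) : monom a n ^+ k = monom (a ^+ k) (n * k%:Z).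
Proof.
elim: k => [|k IH]; first by rewrite !expr0 mulr0.
by rewrite !exprS IH monomM; congr monom; lia.
Qed.

Lemma vanish_ltM N M f g :
  vanish_lt N f -> vanish_lt M g -> vanish_lt (N + M) (f * g).
Proof. by move=> fN gM i; apply: mul_coef_lt. Qed.

Lemma vanish_gtM N M f g :
  vanish_gt N f -> vanish_gt M g -> vanish_gt (N + M) (f * g).
Proof.
move=> fN gM n nNM; apply: fsbig1 => i _.
have [iN|Ni] := ltP N i; first by rewrite fN // mul0r.
by rewrite [X in _ * X]gM ?mulr0 //; lia.
Qed.

Lemma vanish_ltD N f g : vanish_lt N f -> vanish_lt N g -> vanish_lt N (f + g).
Proof. by move=> fN gN i iN; rewrite laurentD fN // gN // addr0. Qed.

Lemma vanish_ltN N f : vanish_lt N f -> vanish_lt N (- f).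
Proof. by move=> fN i iN; rewrite -[LHS]/(- f i) fN // oppr0. Qed.

Lemma vanish_ltB N f g : vanish_lt N f -> vanish_lt N g -> vanish_lt N (f - g).
Proof. by move=> fN gN; apply/vanish_ltD => //; apply: vanish_ltN. Qed.

Lemma vanish_lt_le N M f : N <= M -> vanish_lt M f -> vanish_lt N f.
Proof. by move=> NM fM i iN; apply: fM; lia. Qed.

Lemma vanish_lt_monom a n : vanish_lt n (monom a n).
Proof. by move=> i /lt_eqF /= ->. Qed.

Lemma vanish_gt_monom a n : vanish_gt n (monom a n).
Proof. by move=> i /gt_eqF /= ->. Qed.

Lemma vanish_lt1 : vanish_lt 0 (1 : laurent A). Proof. exact: vanish_lt_monom. Qed.

Lemma vanish_lt_1sub_monom a (n : nat) : vanish_lt 0 (1 - monom a n).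
Proof.
by apply: vanish_ltB; [exact: vanish_lt1 | apply: vanish_lt_le (@vanish_lt_monom _ _)].
Qed.

Lemma coef0M f g : vanish_lt 0 f -> vanish_lt 0 g -> (f * g) 0 = f 0 * g 0.
Proof.
move=> f0 g0; have := mul_coefE f0 g0 (leqnn 1); rewrite !addr0 coef_laurentM => ->.
by rewrite coefM big_ord1 !coef_poly !addr0.
Qed.

Lemma vanish_lt_eq0 f : (forall L : nat, vanish_lt L f) -> f = 0.
Proof. by move=> fL; apply: laurentP => i; apply: (fL `|i|.+1); lia. Qed.

(** Completeness of A[[t]]; the n-th coefficient is read off at step n + 1,
    from which on it no longer changes. *)
Lemma laurent_limit (u : nat -> laurent A) :
  (forall k : nat, vanish_lt 0 (u k)) -> (forall k : nat, vanish_lt k (u k.+1 - u k)) ->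
  exists l, forall k : nat, vanish_lt k (l - u k).
Proof.
move=> u0 uS.
have lbd : (fun i : int => if i < 0 then 0 else u `|i|.+1 i) \in @bounded_below A.
  by apply/bounded_belowP; exists 0 => i ->.
exists (Laurent lbd) => k i ik; rewrite laurentB /=.
have stab (d n : nat) : i < n -> u (n + d)%N i = u n i.
  move=> ni; elim: d => [|d IH]; first by rewrite addn0.
  by apply/eqP; rewrite addnS -IH -subr_eq0 -laurentB (uS (n + d)%N) //; lia.
case: ltP => i0; first by rewrite u0 // subrr.
have ii : i < `|i|.+1 by lia.
have [ki|/ltnW ki] := leqP k `|i|.+1.
  by rewrite -(subnKC ki) stab // subrr.
by rewrite -(subnKC ki) stab // subrr.
Qed.

(** The inverse is built coefficient by coefficient: V k is an inverse modulo
    t^k, and c k (V k) is the correction of its k-th coefficient. *)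
Lemma power_series_inv W : vanish_lt 0 W -> W 0 \is a GRing.unit ->
  exists v, vanish_lt 0 v /\ W * v = 1.
Proof.
move=> W0 Wu.
pose c (k : nat) v := (W * v - 1) k / W 0.
pose V := fix V (k : nat) := if k is k'.+1 then V k' - monom (c k' (V k')) k' else 0.
have V0 k : vanish_lt 0 (V k).
  elim: k => [|k IH] //=; apply: vanish_ltB => //.
  exact: vanish_lt_le (@vanish_lt_monom _ _).
have WV (k : nat) : vanish_lt k (W * V k - 1).
  elim: k => [|k IH]; first by rewrite mulr0; apply: vanish_ltB => //; exact: vanish_lt1.
  rewrite /= -/V.
  have -> : W * (V k - monom (c k (V k)) k) - 1 = (W * V k - 1) - monom (c k (V k)) k * W.
    by ring.
  move=> i; rewrite laurentB coef_monomM => ik.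
  have [{}ik|ki] := ltP i k; first by rewrite IH // W0 ?mulr0 ?subrr //; lia.
  have -> : i = k by lia.
  by rewrite subrr /c divrK // subrr.
have [|v vV] := laurent_limit V0.
  move=> k i ik; rewrite /= addrAC subrr add0r.
  by rewrite -[LHS]/(- (monom (c k (V k)) k i)) vanish_lt_monom // oppr0.
exists v; split.
  by rewrite -(subrK (V 0%N) v); apply: vanish_ltD => //; apply: vV.
apply/eqP; rewrite -subr_eq0; apply/eqP/vanish_lt_eq0 => L.
have -> : W * v - 1 = W * (v - V L) + (W * V L - 1) by ring.
by apply: vanish_ltD; [rewrite -[L%:Z]add0r; apply: vanish_ltM | apply: WV].
Qed.

(** Greedy extraction: if S k = 1 modulo t^(k+1), dividing by the factor
    1 - c t^(k+1) with the same coefficient in degree k + 1 gives a series equal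
    to 1 modulo t^(k+2). *)
Lemma power_series_expansion f : vanish_lt 0 f -> f 0 = 1 ->
  exists c : nat -> A, is_infprod (fun i : nat => 1 - monom (c i) i%:Z) f.
Proof.
move=> f0 f1.
pose G (k : nat) g := 1 - monom (- g k%:Z) k.
pose S := fix S (k : nat) := if k is k'.+1 then S k' / G k'.+1 (S k') else f.
have Ginv (k : nat) g : exists2 v, vanish_lt 0 v & G k.+1 g * v = 1.
  have [||v [v0 Gv]] := @power_series_inv (G k.+1 g).
  - by apply: vanish_lt_1sub_monom.
  - by rewrite /G laurentB laurent1 vanish_lt_monom // subr0 unitr1.
  by exists v.
have Gunit k g : G k.+1 g \is a GRing.unit.
  by have [v _ Gv] := Ginv k g; apply/unitrPr; exists v.
have Gdiv0 k g : vanish_lt 0 (G k.+1 g)^-1.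
  have [v v0 Gv] := Ginv k g.
  by rewrite -[_^-1]mulr1 -Gv mulKr.
have SE (k : nat) : vanish_lt k.+1 (S k - 1).
  elim: k => [|k IH].
    move=> i i1; rewrite laurentB laurent1 /=.
    have [->|/eqP i0] := eqVneq i 0; first by rewrite f1 subrr.
    by rewrite subr0 f0 //; lia.
  have -> : S k.+1 - 1 = (S k - G k.+1 (S k)) / G k.+1 (S k).
    by rewrite mulrBl divrr.
  rewrite -[k.+2%:Z]addr0; apply: vanish_ltM => // i ik.
  have -> : S k - G k.+1 (S k) = (S k - 1) + monom (- S k k.+1%:Z) k.+1.
    by rewrite /G; ring.
  have [->|/eqP iN] := eqVneq i k.+1.
    by rewrite laurentD laurentB laurent1 [monom _ _ _]/= eqxx subr0 subrr.
  by rewrite laurentD IH ?vanish_lt_monom ?addr0 //; lia.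
(* The i-th factor is read off the series left after i - 1 steps. *)
exists (fun i : nat => - S i.-1 i%:Z).
have fS (N : nat) : f = (\prod_(1 <= i < N.+1) (1 - monom (- S i.-1 i%:Z) i%:Z)) * S N.
  elim: N => [|N IH]; first by rewrite big_nil mul1r.
  by rewrite big_nat_recr //= -mulrA -/(G N.+1 (S N)) mulrC mulrCA divrr // mulr1 mulrC.
move=> n; exists `|n|%N => k nk i ik; set p := \prod_(1 <= i < _) _.
have p0 : vanish_lt 0 p.
  rewrite /p; apply: (big_ind (vanish_lt 0)) => [|g h g0 h0|j _]; first exact: vanish_lt1.
    by rewrite -[0]addr0; apply: vanish_ltM.
  exact: vanish_lt_1sub_monom.
apply/eqP; rewrite -subr_eq0 -laurentB (fS k) -/p.
have -> : p - p * S k = - (p * (S k - 1)) by ring.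
apply/eqP; apply: (@vanish_ltN k.+1) => //; last by lia.
by rewrite -[k.+1%:Z]add0r; apply: vanish_ltM.
Qed.

End LaurentCalculus.

(** * Existence of expansions *)

Section PrincipalPart.
Variable A : comUnitRingType.
(** A filtration of A by ideals that is compatible with products and vanishes
    from M on.  The series without positive powers of t whose coefficient of
    t^(-i) lies in F i are stable under products, and have no term of degree
    -M or less. *)
Variable F : nat -> set A.
Hypotheses (iF : forall p, ideal (F p)) (F0 : F 0%N = setT).
Hypothesis FM : forall p q x y, F p x -> F q y -> F (p + q)%N (x * y).
Variable M : nat.
Hypothesis FM0 : forall p x, (M <= p)%N -> F p x -> x = 0.
Implicit Types g h : laurent A.

Let graded g := vanish_gt 0 g /\ forall i : nat, F i (g (- i%:Z)).

Let gradedM g h : graded g -> graded h -> graded (g * h).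
Proof.
move=> [g0 Fg] [h0 Fh]; split; first by rewrite -[0]addr0; apply: vanish_gtM.
move=> i; apply: ideal_coefM => // j; have [I0 _ _] := iF i.
have [j0|j0] := ltP 0 j; first by rewrite g0 // mul0r.
have [ij|ij] := ltP 0 (- i%:Z - j); first by rewrite [X in _ * X]h0 ?mulr0.
have [p pE] : exists p : nat, j = - p%:Z by exists `|j|%N; lia.
have [q qE] : exists q : nat, - i%:Z - j = - q%:Z by exists `|(i%:Z + j)%R|%N; lia.
have -> : i = (p + q)%N by lia.
rewrite (_ : - (p + q)%N%:Z - j = - q%:Z); last by lia.
by rewrite pE; apply: FM.
Qed.

(** Greedy extraction in powers of 1/t.  Nothing bounds a priori the degree of
    the series that remains after removing a factor, but its coefficients stay
    in the filtration, so it is 1 once K reaches M. *)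
Lemma principal_part_expansion g K d :
  (0 < K)%N -> (K + d = M)%N ->
  vanish_gt 0 g -> g 0 = 1 -> (forall i : nat, F i (g (- i%:Z))) ->
  (forall i : int, - K%:Z < i -> i < 0 -> g i = 0) ->
  exists c : nat -> A, [/\ forall i, F i (c i), forall i, (M <= i)%N -> c i = 0 &
    g = \prod_(K <= i < M) (1 - monom (c i) (- i%:Z))].
Proof.
have F0' p : F p 0 by case: (iF p).
elim: d => [|d IH] in K g *.
  rewrite addn0 => K0 KM g0 g1 Fg gK; exists (fun=> 0); split => //.
  rewrite KM big_geq //; apply: laurentP => i; rewrite laurent1.
  case: (ltgtP i 0) => [i0|/g0->|->] //=.
  have [Ki|iK] := ltP (- K%:Z) i; first exact: gK.
  have iE : i = - `|i|%N%:Z by lia.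
  by rewrite iE; apply: (FM0 (p := `|i|%N)); [lia | apply: Fg].
move=> K0 KdM g0 g1 Fg gK.
set a := - g (- K%:Z).
have Fa : F K a by apply: idealN => //; apply: Fg.
have Fal l : F (l * K)%N (a ^+ l).
  elim: l => [|l IHl]; first by rewrite mul0n F0.
  by rewrite exprS mulSn; apply: FM.
have aM : a ^+ M = 0 by apply: (FM0 (p := (M * K)%N)) => //; rewrite leq_pmulr.
pose G := 1 - monom a (- K%:Z).
pose h := \sum_(l < M) monom a (- K%:Z) ^+ l.
(* The geometric series is finite, as a is nilpotent. *)
have Gh : G * h = 1.
  have := subrX1 (monom a (- K%:Z)) M; rewrite monomX aM monom0 sub0r => Xh.
  by rewrite -[LHS]opprK -mulNr opprB -Xh opprK.
have grh : graded h.
  split=> [i i0|i]; rewrite laurent_sum.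
    by rewrite big1 // => l _; rewrite monomX vanish_gt_monom //; lia.
  apply: ideal_sum => // l _; rewrite monomX /=; case: eqP => // iE.
  by have -> : i = (l * K)%N by lia.
have gG : vanish_gt (- K.+1%:Z) (g - G).
  move=> i Ki; rewrite /G opprB addrCA [monom _ _ + _]addrC.
  have [->|/eqP iK] := eqVneq i (- K%:Z).
    rewrite laurentD laurentB laurent1 /= eqxx oppr_eq0 eqz_nat gtn_eqF //.
    by rewrite subr0 /a subrr.
  rewrite laurentD laurentB laurent1 vanish_gt_monom ?addr0; last by lia.
  have [i0|i0|->] := ltgtP i 0; rewrite ?g1 ?subrr ?subr0 //.
    by apply: gK; lia.
  exact: g0.
have g'E : vanish_gt (- K.+1%:Z) (g * h - 1).
  rewrite -Gh -mulrBl -[- K.+1%:Z]addr0; apply: vanish_gtM => //.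
  by case: grh.
have g'E' i : - K.+1%:Z < i -> (g * h) i = (1 : laurent A) i.
  by move=> /g'E; rewrite laurentB => /eqP; rewrite subr_eq0 => /eqP.
have [gh0 ghF] := gradedM (conj g0 Fg) grh.
have [||||||c [Fc cM ghE]] := IH K.+1 (g * h) => //.
- by rewrite addSnnS.
- by rewrite g'E' // laurent1.
- by move=> i Ki i0; rewrite g'E' // laurent1 lt_eqF.
exists (fun i => if i == K then a else c i); split => [i|i Mi|].
- by case: eqP => [->|_].
- by case: eqP => [iK|_]; [move: Mi; lia | apply: cM].
rewrite big_ltn; last by lia.
rewrite eqxx -/G; transitivity (G * h * g); first by rewrite Gh mul1r.
rewrite -mulrA [h * g]mulrC ghE; congr (_ * _).
apply: eq_big_nat => i /andP[Ki _].
by rewrite gtn_eqF.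
Qed.

End PrincipalPart.

Lemma ceil_divnD n i j :
  ((i + j + n) %/ n.+1 <= (i + n) %/ n.+1 + (j + n) %/ n.+1)%N.
Proof.
rewrite -ltnS ltn_divLR // mulSn mulnDl.
have := ltn_ceil (i + n) (ltn0Sn n); have := ltn_ceil (j + n) (ltn0Sn n).
rewrite !mulSn; lia.
Qed.

Section Existence.
Variables (A : comUnitRingType) (m : set A).
Hypotheses (Aart : artinian A) (Aloc : is_local_with m).
Implicit Types f g h : laurent A.

Let im := local_ideal Aloc.
Local Notation J := (idealX m).

(** The coefficients of a unit are not all in m, for otherwise 1, a
    coefficient of f^-1 f, would be; take the first one outside m. *)
Lemma unit_order f : f \is a GRing.unit ->
  exists w : int, f w \is a GRing.unit /\ forall i, i < w -> m (f i).
Proof.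
move=> fU.
have [i0 fi0] : exists i, ~ m (f i).
  apply: contrapT => nf; apply: (local_proper Aloc).
  have -> : 1 = (f^-1 * f) 0 :> A by rewrite mulVr // laurent1.
  apply: ideal_coefM => // i; case: im => _ _; apply.
  by apply: contrapT => fN; apply: nf; eexists; exact: fN.
have [N fN] := laurent_lb f.
have Ni0 : N <= i0.
  by rewrite leNgt; apply/negP => /fN f0; apply: fi0; rewrite f0; case: im.
have exn : exists n : nat, `[< ~ m (f (N + n%:Z)) >].
  by exists `|(i0 - N)%R|%N; apply/asboolP; rewrite (_ : N + _ = i0) //; lia.
case: (ex_minnP exn) => n /asboolP fn nmin.
exists (N + n%:Z); split; first exact: local_unit Aloc _ fn.
move=> i iN; have [/fN->|Ni] := ltP i N; first by case: im.
apply: contrapT => mfi; have : (n <= `|(i - N)%R|)%N.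
  by apply: nmin; apply/asboolP; rewrite (_ : N + _ = i) //; lia.
by lia.
Qed.

Fact nonneg_bounded f : (fun i : int => if 0 <= i then f i else 0) \in @bounded_below A.
Proof. by apply/bounded_belowP; exists 0 => i; rewrite ltNge => /negPf->. Qed.

Definition nonneg_part f := Laurent (nonneg_bounded f).

Lemma vanish_lt_nonneg_part f : vanish_lt 0 (nonneg_part f).
Proof. by move=> i; rewrite /= ltNge => /negPf->. Qed.

Lemma idealX_coefM f g p q :
  (forall i, J p (f i)) -> (forall i, J q (g i)) -> forall i, J (p + q) ((f * g) i).
Proof.
move=> fJ gJ i; apply: ideal_coefM; first exact: ideal_idealX.
by move=> j; apply: idealXM.
Qed.

(** A multiplier q that turns f into 1 plus a principal part in m.  Correcting
    q by the inverse of the nonnegative part of f times the error leaves an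
    error which is multiplied by the negative part of f, so the order of the
    error in powers of m grows by one at each step. *)
Lemma weierstrass_preparation f : f 0 \is a GRing.unit -> (forall i, i < 0 -> m (f i)) ->
  exists q, [/\ vanish_lt 0 q, q 0 \is a GRing.unit,
                vanish_gt 0 (f * q), (f * q) 0 = 1 &
                forall i, i < 0 -> m ((f * q) i)].
Proof.
move=> f0 fm; have [m0 mD mM] := im.
pose fp := nonneg_part f; pose fn := f - fp.
have fp0 : vanish_lt 0 fp by apply: vanish_lt_nonneg_part.
have fnm i : m (fn i).
  rewrite /fn laurentB /=; case: (leP 0 i) => i0; first by rewrite subrr.
  by rewrite subr0; apply: fm.
have [iota [iota0 fiota]] : exists v, vanish_lt 0 v /\ fp * v = 1 by apply: power_series_inv.
have fE : f = fp + fn by rewrite /fn addrCA subrr addr0.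
have step k : exists q, vanish_lt 0 q /\ forall i, 0 <= i -> J k ((f * q - 1) i).
  elim: k => [|k [q [q0 qJ]]]; first by exists 0; split.
  pose err := nonneg_part (f * q - 1).
  have errJ i : J k (err i).
    by rewrite /=; case: leP => i0; [apply: qJ | case: (ideal_idealX m k)].
  exists (q - iota * err); split.
    apply: vanish_ltB => //; rewrite -[0]addr0; apply: vanish_ltM => //.
    exact: vanish_lt_nonneg_part.
  move=> i i0.
  have -> : f * (q - iota * err) - 1 = ((f * q - 1) - err) - fn * (iota * err).
    by rewrite [in f * (_ - _)]fE -[err in _ - err - _]mul1r -fiota [in f * q]fE; ring.
  rewrite laurentB laurentB [err i]/= i0 subrr sub0r.
  apply: (idealN (ideal_idealX m k.+1)).
  rewrite -addn1 addnC; apply: idealX_coefM => [j|j]; first exact: sub_idealX1.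
  rewrite -[k]add0n; apply: idealX_coefM => //.
have [e Je] := maximal_nilpotent Aart Aloc.
have [q [q0 qJ]] := step e.
have fq1 i : 0 <= i -> (f * q) i = (i == 0)%:R.
  by move=> i0; apply/eqP; rewrite -laurent1 -subr_eq0 -laurentB; apply/eqP/Je/qJ.
have fnq i : m ((fn * q) i) by apply: ideal_coefM => // j; rewrite mulrC; apply: mM.
have fqE i : (f * q) i = (fp * q) i + (fn * q) i by rewrite -laurentD -mulrDl -fE.
exists q; split => //.
- apply: (local_unit Aloc) => mq0; apply: (local_proper Aloc).
  have -> : 1 = f 0 * q 0 + (fn * q) 0 by rewrite -[f 0]/(fp 0) -coef0M // -fqE fq1.
  by apply: mD => //; apply: mM.
- by move=> i i0; rewrite fq1 ?(ltW i0) // gt_eqF.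
- by rewrite fq1.
- move=> i i0; rewrite fqE (_ : (fp * q) i = 0) ?add0r //.
  by rewrite (vanish_ltM fp0 q0) // addr0.
Qed.

Lemma expansion_exists f : f \is a GRing.unit -> exists w a, expansion m f w a.
Proof.
move=> fU; have [m0 mD mM] := im.
have [w [fw fm]] := unit_order fU.
pose phi := monom 1 (- w) * f.
have phiE i : phi i = f (i + w) by rewrite coef_monomM mul1r opprK.
have [||q [q0 qu hQ Q0 Qm]] := @weierstrass_preparation phi.
- by rewrite phiE add0r.
- by move=> i i0; rewrite phiE; apply: fm; lia.
set Q := phi * q in hQ Q0 Qm.
have [P [P0 qP]] := power_series_inv q0 qu.
have phiPQ : phi = P * Q by rewrite /Q mulrCA [P * _]mulrC qP mulr1.
have fE : f = monom 1 w * (P * Q).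
  by rewrite -phiPQ mulrA monomM mulr1 addrN mul1r.
have Pu : P 0 \is a GRing.unit.
  apply/unitrPr; exists (q 0); rewrite -coef0M // mulrC qP; exact: laurent1.
pose S := monom (P 0)^-1 0 * P.
have S0 : vanish_lt 0 S.
  by rewrite -[0]addr0; apply: vanish_ltM => //; apply: vanish_lt_monom.
have S1 : S 0 = 1 by rewrite coef_monomM subr0 mulVr.
have PS : P = monom (P 0) 0 * S by rewrite mulrA monomM mulrV // addr0 mul1r.
have [c cS] := power_series_expansion S0 S1.
have [N QN] := laurent_lb Q.
pose n := `|N|.+1.
have [e Je] := maximal_nilpotent Aart Aloc.
(* The rounded-up quotient of i by n.  The coefficients of Q lie in m and vanish
   in degree below -n, hence that of t^(-i) lies in m^(cl i), and i |-> m^(cl i)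
   is the filtration required by [principal_part_expansion]. *)
pose cl i := ((i + n.-1) %/ n)%N.
have clD i j : (cl (i + j) <= cl i + cl j)%N.
  exact: ceil_divnD.
(* Beyond n e one has cl i >= e; the successor makes M positive also when e is
   0. *)
pose M := (n * e).+1.
have FM0 p x : (M <= p)%N -> J (cl p) x -> x = 0.
  move=> Mp Jx; apply: Je; apply: idealX_le Jx.
  by rewrite /cl leq_divRL //; move: Mp; rewrite /M mulnC; lia.
have FQ (i : nat) : J (cl i) (Q (- i%:Z)).
  have [iN|Ni] := ltnP n i.
    by rewrite QN; [case: (ideal_idealX m (cl i))|move: iN; rewrite /n; lia].
  have [->|i0] := posnP i; first by rewrite /cl add0n divn_small.
  apply: (@idealX_le _ _ _ 1).
    by rewrite -ltnS ltn_divLR //; move: Ni; rewrite /n; lia.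
  by apply: sub_idealX1; apply: Qm; lia.
have F0 : J (cl 0%N) = setT by rewrite /cl add0n divn_small.
have FM p q' x y : J (cl p) x -> J (cl q') y -> J (cl (p + q')%N) (x * y).
  by move=> Jx Jy; apply: idealX_le (clD p q') _; apply: idealXM.
have [|d [Fd dM QE]] := principal_part_expansion (fun p => ideal_idealX m (cl p))
    F0 FM FM0 (ltn0Sn 0) (add1n (n * e)) hQ Q0 FQ.
  by move=> i; lia.
(* Negz k stands for - (k + 1). *)
pose a (i : int) := match i with
  | Posz 0 => P 0 | Posz k.+1 => c k.+1 | Negz k => d k.+1 end.
have aN k : a (- k.+1%:Z) = d k.+1 by [].
exists w, a; split.
- exact: Pu.
- case=> // k _; rewrite aN; apply: idealX1_sub => //.
  apply: idealX_le (Fd k.+1); rewrite /cl divn_gt0 // /n; lia.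
- by exists M; case=> // k Mk; rewrite aN; apply: dM; lia.
- exists S, Q; split.
  + move=> L; have [K0 KP] := cS L; exists K0 => k Kk i iL; rewrite -(KP k Kk i iL).
    by congr (lcoef _ i); apply: eq_big_nat => -[].
  + move=> L; exists M => k Mk i _; congr (lcoef _ i).
    rewrite QE (@big_cat_nat _ _ _ M) //=; last by lia.
    rewrite [X in _ * X]big_nat_cond [X in _ * X]big1 => [|j /andP[/andP[Mj _] _]].
      by rewrite mulr1; apply: eq_big_nat => -[].
    by case: j Mj => // j Mj; rewrite aN dM // monom0 subr0.
  + by rewrite {1}fE PS !mulrA monomM mul1r addr0.
Qed.

End Existence.

(** * From expansions to polynomials *)

Section PolyLaurent.
Variable A : comUnitRingType.
Implicit Types (p q : {poly A}).

Fact poly_laurent_bounded p :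
  (fun i : int => if i < 0 then 0 else p`_`|i|%N) \in @bounded_below A.
Proof. by apply/bounded_belowP; exists 0 => i ->. Qed.

Definition poly_laurent p : laurent A := Laurent (poly_laurent_bounded p).

Lemma coef_poly_laurent p (k : nat) : poly_laurent p k = p`_k.
Proof. by []. Qed.

Lemma vanish_lt_poly_laurent p : vanish_lt 0 (poly_laurent p).
Proof. by move=> i /= ->. Qed.

Fact poly_laurent_zmod : zmod_morphism poly_laurent.
Proof.
move=> p q; apply: laurentP => i; rewrite laurentB /=.
by case: ifP => _; rewrite ?subrr // coefB.
Qed.

Fact poly_laurent_monoid : monoid_morphism poly_laurent.
Proof.
split=> [|p q]; apply: laurentP => i.
  rewrite laurent1 /=; case: ltP => i0; first by rewrite lt_eqF.
  by rewrite coef1; congr (_%:R); lia.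
have [i0|i0] := ltP i 0.
  have pq0 := vanish_ltM (@vanish_lt_poly_laurent p) (@vanish_lt_poly_laurent q).
  by rewrite vanish_lt_poly_laurent // pq0 // addr0.
have -> : i = 0 + 0 + `|i|%N%:Z by lia.
rewrite coef_laurentM.
rewrite (mul_coefE (@vanish_lt_poly_laurent p) (@vanish_lt_poly_laurent q) (ltnSn _)).
rewrite !add0r coef_poly_laurent !coefM; apply: eq_bigr => j _.
by rewrite !coef_poly !add0r ltn_ord ltnS leq_subr.
Qed.

HB.instance Definition _ :=
  GRing.isZmodMorphism.Build _ _ poly_laurent poly_laurent_zmod.
HB.instance Definition _ :=
  GRing.isMonoidMorphism.Build _ _ poly_laurent poly_laurent_monoid.

Lemma poly_laurent_monom (a : A) (n : nat) : poly_laurent (a *: 'X^n) = monom a n.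
Proof.
apply: laurentP => i /=; case: ltP => i0; first by case: eqP => // iE; lia.
rewrite coefZ coefXn (_ : (`|i|%N == n) = (i == n)); last by lia.
by case: eqP; rewrite ?mulr1 ?mulr0.
Qed.

Lemma poly_laurent_XnsubC (a : A) (n : nat) :
  poly_laurent ('X^n - a%:P) = monom 1 n * (1 - monom a (- n%:Z)).
Proof.
rewrite mulrBr mulr1 monomM mul1r subrr rmorphB /=; congr (_ - _).
  by rewrite -poly_laurent_monom scale1r.
by rewrite -poly_laurent_monom expr0 alg_polyC.
Qed.

Lemma vanish_lt_poly_laurent_dvd p (L : nat) :
  vanish_lt L (poly_laurent p) -> exists q, p = 'X^L * q.
Proof.
move=> pL; exists (drop_poly L p).
rewrite mulrC -[LHS](poly_take_drop L) (_ : take_poly L p = 0) ?add0r //.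
apply/polyP => i; rewrite coef_take_poly coef0; case: ltnP => // iL.
by rewrite -coef_poly_laurent pL.
Qed.

End PolyLaurent.

Section ExpansionPolynomials.
Variable A : comUnitRingType.
Implicit Types a b : int -> A.

(** The factors 1 - a_(-i) t^(-i), cleared of denominators. *)
Definition minus_poly a (n : nat) : {poly A} :=
  \prod_(1 <= i < n.+1) ('X^i - (a (- i%:Z))%:P).

Definition plus_poly a (K : nat) : {poly A} :=
  \prod_(1 <= i < K.+1) (1 - a i%:Z *: 'X^i).

(** The degree of [minus_poly a n], that is, n (n + 1) / 2.  It does not depend
    on [a], so f and g are cleared by the same power of t. *)
Definition tri (n : nat) : nat := \sum_(1 <= i < n.+1) i.

Lemma minus_polyS a n :
  minus_poly a n.+1 = minus_poly a n * ('X^(n.+1) - (a (- n.+1%:Z))%:P).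
Proof. by rewrite /minus_poly big_nat_recr. Qed.

Lemma minus_poly0 a : minus_poly a 0 = 1.
Proof. by rewrite /minus_poly big_nil. Qed.

Lemma triS n : tri n.+1 = (tri n + n.+1)%N.
Proof. by rewrite /tri big_nat_recr. Qed.

Lemma monic_minus_poly a n : minus_poly a n \is monic.
Proof.
elim: n => [|n IH]; first by rewrite minus_poly0 monic1.
by rewrite minus_polyS monicMr // monicXnsubC.
Qed.

Lemma size_minus_poly a n : size (minus_poly a n) = (tri n).+1.
Proof.
elim: n => [|n IH]; first by rewrite minus_poly0 size_poly1 /tri big_nil.
rewrite minus_polyS size_Mmonic ?monic_neq0 ?monic_minus_poly ?monicXnsubC //.
by rewrite IH size_XnsubC // triS addSn addnS.
Qed.

Lemma minus_poly_laurent a n :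
  poly_laurent (minus_poly a n) =
  monom 1 (tri n) * \prod_(1 <= i < n.+1) (1 - monom (a (- i%:Z)) (- i%:Z)).
Proof.
elim: n => [|n IH].
  by rewrite minus_poly0 /tri !big_nil rmorph1 mulr1.
rewrite minus_polyS rmorphM /= IH poly_laurent_XnsubC [in RHS]big_nat_recr //=.
by rewrite mulrACA monomM mulr1 triS PoszD.
Qed.

Lemma plus_poly_laurent a K :
  poly_laurent (plus_poly a K) = \prod_(1 <= i < K.+1) (1 - monom (a i%:Z) i%:Z).
Proof.
rewrite rmorph_prod; apply: eq_bigr => i _.
by rewrite rmorphB rmorph1 /= poly_laurent_monom.
Qed.

Lemma plus_poly_at0 a K : (plus_poly a K).[0] = 1.
Proof.
rewrite horner_prod big_nat big1 // => i /andP[i0 _].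
by rewrite hornerD hornerN hornerZ hornerXn -polyC1 hornerC expr0n gtn_eqF // mulr0 subr0.
Qed.

(** X^i - a divides X^(i e) - a^e, which is a power of X. *)
Lemma minus_poly_dvd a n e :
  (forall i : nat, (0 < i)%N -> a (- i%:Z) ^+ e = 0) ->
  exists C, minus_poly a n * C = 'X^(tri n * e).
Proof.
move=> ae; elim: n => [|n [C CE]].
  by exists 1; rewrite minus_poly0 /tri big_nil mul1r.
exists (C * \sum_(i < e) 'X^(n.+1) ^+ (e.-1 - i) * (a (- n.+1%:Z))%:P ^+ i).
rewrite minus_polyS mulrACA CE -subrXX -[_%:P ^+ e]rmorphXn /= ae // subr0.
by rewrite -exprM -exprD triS mulnDl.
Qed.

Lemma pnorm_minus_plus a b n K (c : A) :
  pnorm (minus_poly a n) (c *: plus_poly b K) =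
  c ^+ tri n * \prod_(1 <= i < n.+1) \prod_(1 <= j < K.+1)
    (1 - a (- i%:Z) ^+ (j %/ gcdn i j) * b j%:Z ^+ (i %/ gcdn i j)) ^+ gcdn i j.
Proof.
rewrite -mul_polyC pnormM ?monic_minus_poly // pnormC ?monic_minus_poly //.
rewrite size_minus_poly; congr (_ * _).
rewrite pnorm_prod ?monic_minus_poly // exchange_big /=.
apply: eq_big_nat => j /andP[j0 _].
elim: n => [|n IH]; first by rewrite minus_poly0 pnorm1l big_nil.
rewrite minus_polyS pnorm_mull ?monic_minus_poly ?monicXnsubC // IH [in RHS]big_nat_recr //=.
by congr (_ * _); rewrite pnorm_binomial // [gcdn j _]gcdnC [X in 1 - X]mulrC.
Qed.

(** Up to a power of t and modulo t^L, a series with an expansion is the product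
    of a monic polynomial and a polynomial with constant term a_0.  The
    truncation order L is arbitrary; only the plus part is truncated. *)
Lemma expansion_minus_poly m f w a : expansion m f w a ->
  exists n0, forall n, (n0 <= n)%N -> forall L : nat,
  exists K0, forall K, (K0 <= K)%N -> forall N al : nat,
    w + N%:Z = (al + tri n)%N%:Z ->
    vanish_lt L (monom 1 N * f -
           poly_laurent (('X^al * minus_poly a n) * (a 0 *: plus_poly a K))).
Proof.
move=> [_ _ [n0 a0] [P [Q [Pcvg Qcvg fE]]]].
exists n0 => n n0n L.
have QE : Q = \prod_(1 <= i < n.+1) (1 - monom (a (- i%:Z)) (- i%:Z)).
  apply: laurentP => i; have [N QN] := Qcvg (i + 1).
  rewrite -(QN (maxn N n)) ?leq_maxl //; last by lia.
  congr (lcoef _ i); rewrite (@big_cat_nat _ _ _ n.+1) //=; last first.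
    by rewrite ltnS leq_maxr.
  rewrite [X in _ * X]big_nat_cond [X in _ * X]big1 ?mulr1 // => j /andP[/andP[nj _] _].
  by rewrite a0 ?monom0 ?subr0 // (leq_ltn_trans n0n).
have [K0 PK] := Pcvg L; exists K0 => K K0K N al wN.
set D := 'X^al * _; rewrite -mul_polyC mulrA rmorphM /= plus_poly_laurent.
have -> : monom 1 N * f = poly_laurent (D * (a 0)%:P) * P.
  rewrite !rmorphM /= minus_poly_laurent -QE fE -['X^al]scale1r -[(a 0)%:P]alg_polyC.
  rewrite -(expr0 'X) !poly_laurent_monom.
  have -> : monom 1 al * (monom 1 (tri n) * Q) * monom (a 0) 0%N =
      (monom 1 al * monom 1 (tri n) * monom (a 0) 0%N) * Q by ring.
  rewrite !monomM !mul1r !mulrA monomM mul1r addr0 -PoszD -wN addrC; ring.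
rewrite -mulrBr -[L%:Z]add0r; apply: vanish_ltM; first exact: vanish_lt_poly_laurent.
by move=> i iL; rewrite laurentB PK // subrr.
Qed.

End ExpansionPolynomials.

(** * The Steinberg relation for the symbol *)

Lemma fsbig_pos (R : comNzRingType) (K : nat) (F : nat -> R) :
  (forall i, (K < i)%N -> F i = 1) ->
  \big[*%R/1]_(i \in [set i : nat | (0 < i)%N]) F i = \prod_(1 <= i < K.+1) F i.
Proof.
move=> F1; rewrite (fsbigE (index_iota 1 K.+1)) ?iota_uniq //.
- rewrite big_seq_cond [RHS]big_seq; apply: eq_bigl => i.
  rewrite mem_index_iota; case: (boolP (0 < i < K.+1)%N) => // /andP[i0 _].
  exact/mem_set.
- by move=> i /=; rewrite mem_index_iota => /andP[].
- move=> i /= i0; rewrite mem_index_iota => iK; apply: F1; move: iK; lia.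
Qed.

Lemma fsbig_pos2 (R : comNzRingType) (K n : nat) (F : nat -> nat -> R) :
  (forall i j, (K < i)%N -> (0 < j)%N -> F i j = 1) ->
  (forall i j, (0 < i)%N -> (n < j)%N -> F i j = 1) ->
  \big[*%R/1]_(i \in [set i : nat | (0 < i)%N])
    \big[*%R/1]_(j \in [set i : nat | (0 < i)%N]) F i j =
  \prod_(1 <= i < K.+1) \prod_(1 <= j < n.+1) F i j.
Proof.
move=> FK Fn; rewrite (@fsbig_pos _ K) => [|i Ki]; last first.
  by apply: fsbig1 => j; apply: FK.
by apply: eq_big_nat => i /andP[i0 _]; apply: fsbig_pos => j; apply: Fn.
Qed.

(** The factors of the symbol are trivial outside a rectangle: for j fixed,
    i / gcd(i, j) is at least i / j, and b is nilpotent. *)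
Lemma symbol_factor_eq1 (A : comUnitRingType) (a b : A) (i j e : nat) :
  (0 < i)%N -> (0 < j)%N -> (b = 0 \/ (j * e < i)%N /\ b ^+ e = 0) ->
  (1 - a ^+ (j %/ gcdn i j) * b ^+ (i %/ gcdn i j)) ^+ gcdn i j = 1.
Proof.
move=> i0 j0 bi.
suff -> : b ^+ (i %/ gcdn i j) = 0 by rewrite mulr0 subr0 expr1n.
have g0 : (0 < gcdn i j)%N by rewrite gcdn_gt0 i0.
case: bi => [->|[jei be]].
  by rewrite expr0n -leqn0 leqNgt divn_gt0 // dvdn_leq // dvdn_gcdl.
have /subnK <- : (e <= i %/ gcdn i j)%N; last by rewrite exprD be mulr0.
rewrite leq_divRL // (leq_trans _ (ltnW jei)) // mulnC leq_mul //.
by rewrite dvdn_leq // dvdn_gcdr.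
Qed.

Lemma symbol_factor_unit (A : comUnitRingType) (m : set A) (a b : A) (i j : nat) :
  is_local_with m -> (0 < i)%N -> (0 < j)%N -> m a ->
  (1 - a ^+ (j %/ gcdn i j) * b ^+ (i %/ gcdn i j)) ^+ gcdn i j \is a GRing.unit.
Proof.
move=> Aloc i0 j0 ma; apply/unitrX/(local_unit_1sub Aloc).
have [_ _ mM] := local_ideal Aloc; rewrite mulrC; apply: (mM).
have : (0 < j %/ gcdn i j)%N.
  by rewrite divn_gt0 ?gcdn_gt0 ?i0 // dvdn_leq ?dvdn_gcdr.
by case: (j %/ gcdn i j)%N => // d _; rewrite exprSr; apply: (mM).
Qed.

Lemma exprz_N1_even (R : unitRingType) (k : int) : ((-1) ^ (k * 2)) = 1 :> R.
Proof. by rewrite mulrC -exprz_exp -[(-1) ^ 2]exprnP sqrrN expr1n exp1rz. Qed.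

Theorem theorem3p3 (A : comUnitRingType) (m : set A)
    (Aart : artinian A) (Aloc : is_local_with m)
    (f : laurent A) (fU : f \is a GRing.unit) (f1U : 1 - f \is a GRing.unit) :
  contou_carrere m f (1 - f) = 1.
Proof.
have [e Je] := maximal_nilpotent Aart Aloc.
have me x : m x -> x ^+ e = 0 by move=> mx; apply/Je/idealX_exp.
have xf : expansion m f (winding m f) (ecoef m f).
  have [w [a wa]] := expansion_exists Aart Aloc fU.
  exact: (xgetPex (0, 0) (ex_intro [set wa | expansion m f wa.1 wa.2] (w, a) wa)).
have xg : expansion m (1 - f) (winding m (1 - f)) (ecoef m (1 - f)).
  have [w [a wa]] := expansion_exists Aart Aloc f1U.
  exact: (xgetPex (0, 0) (ex_intro [set wa | expansion m (1 - f) wa.1 wa.2] (w, a) wa)).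
rewrite /contou_carrere.
move: (winding m f) (ecoef m f) xf => w a xf.
move: (winding m (1 - f)) (ecoef m (1 - f)) xg => w' b xg.
have [n1 fn1] := expansion_minus_poly xf.
have [n2 gn2] := expansion_minus_poly xg.
have [a0u am [n3 an3] _] := xf.
have [b0u bm [n4 bn4] _] := xg.
(* A bound for both minus parts. *)
pose n := maxn (maxn n1 n2) (maxn n3 n4).
have an i : (n < i)%N -> a (- i%:Z) = 0.
  by move=> ni; apply: an3; move: ni; rewrite /n; lia.
have bn i : (n < i)%N -> b (- i%:Z) = 0.
  by move=> ni; apply: bn4; move: ni; rewrite /n; lia.
(* The shift t^N makes f and 1 - f power series and their minus parts
   polynomials.  N is even, for the final count of signs. *)
pose N := (`|w| + `|w'| + tri n + 1).*2%N.
have [al alE] : exists al : nat, w + N%:Z = (al + tri n)%N%:Z.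
  by exists `|(w + N%:Z - (tri n)%:Z)%R|%N; rewrite /N; lia.
have [be beE] : exists be : nat, w' + N%:Z = (be + tri n)%N%:Z.
  by exists `|(w' + N%:Z - (tri n)%:Z)%R|%N; rewrite /N; lia.
(* The polynomials D and E below divide X^k, so the relation f + g = 1 is needed
   modulo X^(N + k). *)
pose k := (al + be + tri n * e)%N.
have [|K1 fK1] := fn1 n _ (N + k)%N; first by rewrite /n; lia.
have [|K2 gK2] := gn2 n _ (N + k)%N; first by rewrite /n; lia.
(* Beyond n e the factors of the double products are 1. *)
pose K := maxn (maxn K1 K2) (n * e).
pose D := 'X^al * minus_poly a n; pose U := a 0 *: plus_poly a K.
pose E := 'X^be * minus_poly b n; pose W := b 0 *: plus_poly b K.
have fDU : vanish_lt (N + k)%N (monom 1 N * f - poly_laurent (D * U)).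
  by apply: fK1 => //; rewrite /K; lia.
have gEW : vanish_lt (N + k)%N (monom 1 N * (1 - f) - poly_laurent (E * W)).
  by apply: gK2 => //; rewrite /K; lia.
have [|Y YE] := @vanish_lt_poly_laurent_dvd A (D * U + E * W - 'X^N) (N + k).
  have -> : poly_laurent (D * U + E * W - 'X^N) =
      - ((monom 1 N * f - poly_laurent (D * U)) +
         (monom 1 N * (1 - f) - poly_laurent (E * W))).
    rewrite -['X^N]scale1r rmorphB rmorphD /= poly_laurent_monom; ring.
  by apply: vanish_ltN; apply: vanish_ltD.
have eqDE : D * U + E * W = 'X^N + 'X^(N + k) * Y by rewrite -YE addrCA subrr addr0.
have aN i : (0 < i)%N -> a (- i%:Z) ^+ e = 0 by move=> i0; apply/me/am.
have bN i : (0 < i)%N -> b (- i%:Z) ^+ e = 0 by move=> i0; apply/me/bm.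
have [C CE] : exists C, D * C = 'X^k.
  have [C CE] := minus_poly_dvd n aN; exists (C * 'X^be).
  by rewrite /D -mulrA [_ * (C * _)]mulrA CE mulrA -!exprD /k; congr (_ ^+ _); lia.
have [C' C'E] : exists C, E * C = 'X^k.
  have [C' C'E] := minus_poly_dvd n bN; exists (C' * 'X^al).
  by rewrite /E -mulrA [_ * (C' * _)]mulrA C'E mulrA -!exprD /k; congr (_ ^+ _); lia.
have mD : D \is monic by rewrite monicMr ?monicXn ?monic_minus_poly.
have mE : E \is monic by rewrite monicMr ?monicXn ?monic_minus_poly.
have sD : size D = (al + tri n).+1.
  rewrite size_Mmonic ?monic_neq0 ?monicXn ?monic_minus_poly //.
  by rewrite size_polyXn size_minus_poly addnS.
have sE : size E = (be + tri n).+1.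
  rewrite size_Mmonic ?monic_neq0 ?monicXn ?monic_minus_poly //.
  by rewrite size_polyXn size_minus_poly addnS.
have U0 : U.[0] = a 0 by rewrite hornerZ plus_poly_at0 mulr1.
have W0 : W.[0] = b 0 by rewrite hornerZ plus_poly_at0 mulr1.
have n_gt0 : (0 < al + tri n)%N by move: alE; rewrite /N; lia.
have := @steinberg_pnorm A D E U W Y C C' N k mD _ mE _ CE C'E _ _ eqDE.
rewrite U0 W0 sD sE /= ltnS => /(_ n_gt0 _ a0u b0u).
have N_gt0 : (0 < N)%N by rewrite /N; lia.
move=> /(_ N_gt0); rewrite /D /E !pnorm_mull ?monicXn ?monic_minus_poly //.
rewrite !pnorm_polyXn U0 W0 !pnorm_minus_plus.
set S2 := \prod_(1 <= i < n.+1) _; set S1 := \prod_(1 <= i < n.+1) _.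
(* The double products of the symbol are the products in the two norms. *)
have numE : \big[*%R/1]_(i \in [set i : nat | (0 < i)%N])
    \big[*%R/1]_(j \in [set i : nat | (0 < i)%N])
     (1 - a i%:Z ^+ (j %/ gcdn i j) * b (- j%:Z) ^+ (i %/ gcdn i j)) ^+ gcdn i j = S1.
  rewrite (@fsbig_pos2 _ K n) => [|i j Ki j0|i j i0 nj]; last 2 first.
  - have [jn|nj] := leqP j n; last first.
      by apply: (@symbol_factor_eq1 _ _ _ _ _ e); [lia|lia|left; apply: bn].
    apply: (@symbol_factor_eq1 _ _ _ _ _ e); [lia|lia|right; split; last exact: bN].
    by apply: (leq_ltn_trans _ Ki); rewrite /K leq_max leq_mul ?orbT.
  - by apply: (@symbol_factor_eq1 _ _ _ _ _ e); [lia|lia|left; apply: bn].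
  rewrite exchange_big; apply: eq_bigr => j _; apply: eq_bigr => i _.
  by rewrite [X in 1 - X]mulrC gcdnC.
have denE : \big[*%R/1]_(i \in [set i : nat | (0 < i)%N])
    \big[*%R/1]_(j \in [set i : nat | (0 < i)%N])
     (1 - a (- i%:Z) ^+ (j %/ gcdn i j) * b j%:Z ^+ (i %/ gcdn i j)) ^+ gcdn i j = S2.
  rewrite (@fsbig_pos2 _ n K) // => i j.
    move=> ni j0; rewrite [X in 1 - X]mulrC gcdnC.
    by apply: (@symbol_factor_eq1 _ _ _ _ _ e); [lia|lia|left; apply: an].
  move=> i0 Kj; rewrite [X in 1 - X]mulrC gcdnC.
  have [iln|nli] := leqP i n; last first.
    by apply: (@symbol_factor_eq1 _ _ _ _ _ e); [lia|lia|left; apply: an].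
  apply: (@symbol_factor_eq1 _ _ _ _ _ e); [lia|lia|right; split; last exact: aN].
  by apply: (leq_ltn_trans _ Kj); rewrite /K leq_max leq_mul ?orbT.
rewrite numE denE.
have S2u : S2 \is a GRing.unit.
  rewrite /S2 big_nat; apply: (big_ind (fun x => x \is a GRing.unit)).
  - exact: unitr1.
  - by move=> x y xu yu; rewrite unitrMl.
  move=> i /andP[i0 _]; rewrite big_nat; apply: (big_ind (fun x => x \is a GRing.unit)).
  - exact: unitr1.
  - by move=> x y xu yu; rewrite unitrMl.
  move=> j /andP[j0 _] /=.
  exact: (@symbol_factor_unit A m (a (- i%:Z)) (b j%:Z) i j Aloc i0 j0 (am i i0)).
have bwu : b 0 ^ w \is a GRing.unit by rewrite unitrXz.
move=> key.
set sgn := (-1) ^+ (_ + _ + N) in key.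
(* Cancel the contributions of the shift t^N. *)
have key2 : (-1) ^+ ((al + tri n) * N) * (b 0 ^ w * S2) =
    sgn * (a 0 ^ w' * S1).
  have aNu : a 0 ^+ N * b 0 ^+ N \is a GRing.unit by rewrite unitrM !unitrX.
  apply: (mulIr aNu).
  have bE : b 0 ^ w * b 0 ^+ N = b 0 ^+ al * b 0 ^+ tri n.
    by rewrite -exprD !exprnP -alE exprzDr.
  have aE : a 0 ^ w' * a 0 ^+ N = a 0 ^+ be * a 0 ^+ tri n.
    by rewrite -exprD !exprnP -beE exprzDr.
  transitivity ((-1) ^+ ((al + tri n) * N) * (b 0 ^ w * b 0 ^+ N * S2) * a 0 ^+ N).
    ring.
  rewrite bE -[_ * S2]mulrA key.
  transitivity (sgn * (a 0 ^ w' * a 0 ^+ N * S1) * b 0 ^+ N); last by ring.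
  by rewrite aE -[a 0 ^+ be * _ * S1]mulrA.
have sgn2 x : (-1) ^+ x * (-1) ^+ x = 1 :> A by rewrite -exprMn mulrNN mulr1 expr1n.
have -> : a 0 ^ w' * S1 =
    sgn *
    (-1) ^+ ((al + tri n) * N) * (b 0 ^ w * S2).
  by rewrite -mulrA key2 mulrA sgn2 mul1r.
rewrite mulrK ?unitrM ?bwu //.
rewrite -exprD exprnP -exprzDr ?unitrN1 //.
set z := (X in _ ^ X).
(* With n = w + N and n' = w' + N the degrees, the exponent of -1 is
   w w' + n n' + n' N + N + n N = 2 n n' + N + N^2, which is even. *)
suff -> : z = (((al + tri n) * (be + tri n))%N%:Z + N./2%:Z + (N * N./2)%N%:Z) * 2.
  exact: exprz_N1_even.
have NE : N = (N./2 * 2)%N by rewrite muln2 /N doubleK.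
have wE : w = (al + tri n)%N%:Z - N%:Z by rewrite -alE; ring.
have w'E : w' = (be + tri n)%N%:Z - N%:Z by rewrite -beE; ring.
rewrite /z wE w'E; move: NE; set h := N./2; clearbody h N => ->.
rewrite !PoszD !PoszM; ring.
Qed.
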